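(* Let $X$ be an arbitrary compact complex manifold with $\dim_{\mathbb C} X>1$. Then there exists a smooth Hermitian metric $\omega$ on $X$ with positive total (Chern) scalar curvature. Moreover, if $X$ is Kähler, then there exists a conformally Kähler metric $\omega$ on $X$ with positive total (Chern) scalar curvature, i.e. such a metric of the form $\omega=e^{f}\omega_0$ for some Kähler metric $\omega_0$ and some $f\in C^\infty(X,\mathbb R)$.
   Context: For a smooth Hermitian metric (identified with its positive real $(1,1)$-form) $\omega$ on a complex manifold $X$ of dimension $n$, the (first Chern) Ricci form is $\mathrm{Ric}(\omega)=-\sqrt{-1}\,\partial\bar\partial\log\omega^n$ (locally $-\sqrt{-1}\,\partial\bar\partial\log\det(g_{i\bar j})$), the (Chern) scalar curvature is $s=\mathrm{tr}_\omega\mathrm{Ric}(\omega)$, and the total (Chern) scalar curvature is $\int_X s\,\omega^n=n\int_X\mathrm{Ric}(\omega)\wedge\omega^{n-1}$. *)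

(* Defs.v *)
From HB Require Import structures.
From mathcomp Require Import all_boot all_order all_algebra.
From mathcomp Require Import complex.
From mathcomp Require Import all_classical all_reals all_analysis.

Set Implicit Arguments.
Unset Strict Implicit.
Unset Printing Implicit Defensive.

Import Order.TTheory GRing.Theory Num.Theory.
Import numFieldNormedType.Exports.

Local Open Scope classical_set_scope.
Local Open Scope ring_scope.
Local Open Scope complex_scope.

(* Points of C^n are written in real coordinates: p : 'rV[R]_(n + n) stands for
   z_k = x_k + i y_k with x_k = p (lshift n k) and y_k = p (rshift n k). *)

Section Smooth.
Context {R : realType}.

Definition partial {m : nat} (k : 'I_m) (f : 'rV[R]_m -> R) : 'rV[R]_m -> R :=
  fun p => 'D_(delta_mx 0 k) f p.

(* f is C^oo on the open set U: all iterated partial derivatives exist and are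
   continuous at every point of U. *)
Definition smooth_on {m : nat} (U : set 'rV[R]_m) (f : 'rV[R]_m -> R) : Prop :=
  forall (s : seq 'I_m) (p : 'rV[R]_m), U p ->
    {for p, continuous (foldr partial f s)} /\
    forall k : 'I_m, derivable (foldr partial f s) p (delta_mx 0 k).

Definition csmooth_on {m : nat} (U : set 'rV[R]_m) (f : 'rV[R]_m -> R[i]) :
    Prop :=
  smooth_on U (fun p => complex.Re (f p)) /\
  smooth_on U (fun p => complex.Im (f p)).

Definition cpartial {m : nat} (k : 'I_m) (f : 'rV[R]_m -> R[i]) :
    'rV[R]_m -> R[i] :=
  fun p => partial k (fun q => complex.Re (f q)) p
           +i* partial k (fun q => complex.Im (f q)) p.

(* Wirtinger derivatives d/dz_k and d/dzbar_k. *)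
Definition dz {n : nat} (k : 'I_n) (f : 'rV[R]_(n + n) -> R[i]) :
    'rV[R]_(n + n) -> R[i] :=
  fun p => (cpartial (lshift n k) f p - 'i * cpartial (rshift n k) f p) / 2.

Definition dzbar {n : nat} (k : 'I_n) (f : 'rV[R]_(n + n) -> R[i]) :
    'rV[R]_(n + n) -> R[i] :=
  fun p => (cpartial (lshift n k) f p + 'i * cpartial (rshift n k) f p) / 2.

Definition zcoord {n : nat} (k : 'I_n) (p : 'rV[R]_(n + n)) : R[i] :=
  p 0 (lshift n k) +i* p 0 (rshift n k).

Definition holomorphic_on {n : nat} (U : set 'rV[R]_(n + n))
    (F : 'rV[R]_(n + n) -> 'rV[R]_(n + n)) : Prop :=
  forall k : 'I_n, csmooth_on U (fun p => zcoord k (F p)) /\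
    forall (l : 'I_n) p, U p -> dzbar l (fun q => zcoord k (F q)) p = 0.

(* (k, a) entry: d w_a / d z_k, where w = F(z). *)
Definition hjacobian {n : nat} (F : 'rV[R]_(n + n) -> 'rV[R]_(n + n))
    (p : 'rV[R]_(n + n)) : 'M[R[i]]_n :=
  \matrix_(k, a) dz k (fun q => zcoord a (F q)) p.

(* Integral of f with respect to Lebesgue measure on R^m, as an iterated
   one-dimensional Lebesgue integral; it is only applied below to continuous
   functions with compact support. *)
Fixpoint iterated_integral (m : nat) : ('rV[R]_m -> R) -> R :=
  match m with
  | 0 => fun f => f 0
  | m'.+1 => fun f => \int[lebesgue_measure]_(t in [set: R])
      iterated_integral
        (fun v : 'rV[R]_m' => f (row_mx (const_mx t : 'rV[R]_1) v))
  end.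

End Smooth.

Record complexManifold (R : realType) (n : nat) := ComplexManifold {
  carrier :> topologicalType ;
  index : Type ;
  dom : index -> set carrier ;
  chart : index -> carrier -> 'rV[R]_(n + n) ;
  chartV : index -> 'rV[R]_(n + n) -> carrier ;
  manifold_hausdorff : hausdorff_space carrier ;
  manifold_second_countable : @second_countable carrier ;
  dom_cover : forall x : carrier, exists i, dom i x ;
  dom_open : forall i, open (dom i) ;
  codom_open : forall i, open (chart i @` dom i) ;
  chartK : forall i x, dom i x -> chartV i (chart i x) = x ;
  chart_continuous :
    forall i x, dom i x -> {for x, continuous (chart i)} ;
  chartV_continuous :
    forall i p, (chart i @` dom i) p -> {for p, continuous (chartV i)} ;
  transition_holomorphic : forall i j,
    holomorphic_on (chart i @` (dom i `&` dom j)) (chart j \o chartV i)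
}.

Section Geometry.
Context {R : realType} {n : nat} (X : complexManifold R n).

Definition codom_of (i : index X) : set 'rV[R]_(n + n) :=
  @chart R n X i @` dom i.

Definition transition (i j : index X) : 'rV[R]_(n + n) -> 'rV[R]_(n + n) :=
  @chart R n X j \o chartV i.

Definition smooth_fun (f : X -> R) : Prop :=
  forall i : index X, smooth_on (codom_of i) (f \o chartV i).

(* A real (1,1)-form  omega = sqrt(-1) sum g_{k lbar} dz_k /\ dzbar_l  is given
   by its coefficient matrices (g i p) k l = g_{k lbar}(p) in every chart i;
   only their values on codom_of i are meaningful. *)
Definition local_forms : Type := index X -> 'rV[R]_(n + n) -> 'M[R[i]]_n.

Definition adjmx {a b : nat} (A : 'M[R[i]]_(a, b)) : 'M[R[i]]_(b, a) :=
  (map_mx Num.conj A)^T.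

Record hermitian_metric (g : local_forms) : Prop := HermitianMetric {
  metric_smooth : forall (i : index X) (k l : 'I_n),
    csmooth_on (codom_of i) (fun p => g i p k l) ;
  metric_hermitian : forall (i : index X) p, codom_of i p ->
    adjmx (g i p) = g i p ;
  metric_positive : forall (i : index X) p, codom_of i p ->
    forall v : 'rV[R[i]]_n, v != 0 -> 0 < (v *m g i p *m adjmx v) 0 0 ;
  metric_glue : forall (i j : index X) p,
    (@chart R n X i @` (dom i `&` dom j)) p ->
    g i p = hjacobian (transition i j) p *m g j (transition i j p)
            *m adjmx (hjacobian (transition i j) p)
}.

(* d omega = 0: the first equation is the vanishing of the (2,1)-part of
   d omega, the second one that of its (1,2)-part. *)
Definition closed_form (g : local_forms) : Prop :=
  forall (i : index X) p, codom_of i p -> forall k l m : 'I_n,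
    dz k (fun q => g i q l m) p = dz l (fun q => g i q k m) p /\
    dzbar k (fun q => g i q m l) p = dzbar l (fun q => g i q m k) p.

Definition kahler_metric (g : local_forms) : Prop :=
  hermitian_metric g /\ closed_form g.

Definition conformal (f : X -> R) (g : local_forms) : local_forms :=
  fun i p => (expR (f (chartV i p)))%:C *: g i p.

(* Coefficients of  Ric(omega) = - sqrt(-1) ddbar log det g;  the determinant of
   a positive Hermitian matrix is a positive real number. *)
Definition ricci (g : local_forms) : local_forms :=
  fun i p => \matrix_(k, l)
    - dz k (dzbar l (fun q => (ln (complex.Re (\det (g i q))))%:C)) p.

(* tr_omega Ric(omega), which is a real number. *)
Definition scalar_curvature (g : local_forms) (i : index X)
    (p : 'rV[R]_(n + n)) : R :=
  complex.Re (\tr (invmx (g i p) *m ricci g i p)).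

(* Density of omega^n with respect to Lebesgue measure dx_1 dy_1 ... dx_n dy_n:
   omega^n = n! det g  prod_k (sqrt(-1) dz_k /\ dzbar_k)  and
   sqrt(-1) dz /\ dzbar = 2 dx /\ dy. *)
Definition top_power (g : local_forms) (i : index X) (p : 'rV[R]_(n + n)) : R :=
  n`!%:R * 2 ^+ n * complex.Re (\det (g i p)).

(* A finite smooth partition of unity, each function being labelled by a chart
   whose domain contains its support. *)
Definition partition_of_unity (s : seq (index X * (X -> R))) : Prop :=
  (forall k, (k < size s)%N -> forall d,
     let a := nth d s k in
     [/\ smooth_fun a.2, forall x, 0 <= a.2 x
       & closure [set x | a.2 x != 0] `<=` dom a.1]) /\
  (forall x : X, \sum_(a <- s) a.2 x = 1).

(* Some partition of unity subordinate to the atlas.  One exists when X is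
   compact, and the integral below does not depend on the choice. *)
Definition some_partition : seq (index X * (X -> R)) :=
  match pselect (exists s, partition_of_unity s) with
  | left ex => projT1 (cid ex)
  | right _ => [::]
  end.

(* Integral over (compact) X of the top-degree form that in chart i is
   h i p dx_1 dy_1 ... dx_n dy_n. *)
Definition manifold_integral (h : index X -> 'rV[R]_(n + n) -> R) : R :=
  \sum_(a <- some_partition)
    iterated_integral
      (fun p => \1_(codom_of a.1) p * (a.2 (chartV a.1 p) * h a.1 p)).

Definition total_scalar_curvature (g : local_forms) : R :=
  manifold_integral (fun i p => scalar_curvature g i p * top_power g i p).

End Geometry.

(* Main.v *)
From Pilot Require Import Defs.
From HB Require Import structures.
From mathcomp Require Import all_boot all_order all_algebra.
From mathcomp Require Import complex.
From mathcomp Require Import all_classical all_reals all_analysis.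
From mathcomp Require Import ring lra.

Set Implicit Arguments.
Unset Strict Implicit.
Unset Printing Implicit Defensive.

(* Restores the meaning of [index] for manifolds, hidden by that for sequences. *)
Import Pilot.Defs.
Import Order.TTheory GRing.Theory Num.Theory.
Import numFieldNormedType.Exports.

Local Open Scope classical_set_scope.
Local Open Scope ring_scope.
Local Open Scope complex_scope.

(** Let g be any Hermitian metric on X and f a smooth function.  The Ricci form of
    exp(t f) g is Ric(g) - n t ddbar f, so in every chart the total scalar
    curvature of exp(t f) g is the integral of
      exp((n - 1) t f) (s - n t Lap f) det g,
    up to a constant factor, where Lap f is the g-trace of the complex Hessian of
    f ([conformal_density]).  Since n > 1, for large t the weight concentrates at
    the maximum of f, where - Lap f is positive if the maximum is nondegenerate.
    Hence the total curvature of exp(t f) g is positive for large t.  This applies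
    to every g: with g Kaehler it gives the second claim, and with g an arbitrary
    Hermitian metric the first one.

    The function f is a bump h(r^2 - |z - z(x0)|^2) in a chart z around a point
    x0, with h(x) = exp(-1/x) for x > 0 and 0 otherwise.  It is smooth on X, its
    superlevel sets shrink to x0 ([bump_level]), and its complex Hessian at x0 is
    - h'(r^2) J J^* in any chart, with J the Jacobian of the change of coordinates
    ([bump_hessian]).  The transformation rule of the metric turns its g-trace
    into - h'(r^2) times the trace of the inverse of g in the chart z, which is
    negative in every chart at once ([hessian_density_center]).

    The integral over X is a sum of integrals over charts, weighted by an
    unspecified partition of unity.  The estimates are therefore made separately
    in each chart of the partition: the integrand is bounded below by a positive
    function weighted by exp((n - 1) t (max f - e / 2)), minus a term with weight
    (1 + t) exp((n - 1) t (max f - e)) ([conformal_integrand_bound]).  After that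
    only linearity, monotonicity and strict positivity of iterated integrals of
    continuous functions with compact support are used.

    The same bumps provide partitions of unity on X ([partition_exists]), and
    averaging the flat metrics of the charts with such a partition provides
    Hermitian metrics ([hermitian_metric_exists]), by the chain rule for
    holomorphic Jacobians ([jacobian_cocycle]).  That chain rule rests
    on the differentiability of functions with continuous partial derivatives
    ([C1_differentiable]). *)

(** * Continuous partial derivatives give a differential *)

Section C1Differentiable.
Context {R : realType}.

Lemma cvg_sum_seq (T : Type) (F : set_system T) (FF : Filter F) (I : Type)
    (r : seq I) (P : pred I) (f : I -> T -> R) (l : I -> R) :
  (forall i, P i -> f i x @[x --> F] --> l i) ->
  \sum_(i <- r | P i) f i x @[x --> F] --> \sum_(i <- r | P i) l i.
Proof.
move=> fl; elim: r => [|a r IH].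
  under eq_fun do rewrite big_nil.
  by rewrite big_nil; exact: cvg_cst.
under eq_fun do rewrite big_cons.
rewrite big_cons; case: ifPn => // Pa.
by apply: cvgD => //; exact: fl.
Qed.

Lemma coord_le_norm m (v : 'rV[R]_m) k : `|v 0 k| <= `|v|.
Proof.
rewrite [leRHS]/Num.Def.normr /= mx_normrE.
exact: (@le_bigmax _ _ _ 0 (fun ij => `|v ij.1 ij.2|) (0, k)).
Qed.

Lemma norm_le_coord m (v : 'rV[R]_m) e : 0 <= e ->
  (forall k, `|v 0 k| <= e) -> `|v| <= e.
Proof.
move=> e0 H; rewrite [leLHS]/Num.Def.normr /= mx_normrE; apply: bigmax_le => // -[i j] _ /=.
by rewrite ord1; exact: H.
Qed.

(** The mean value theorem on a segment parallel to the k-th axis turns the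
    oscillation of the partial derivative around c into an error bound. *)
Lemma partial_increment m (k : 'I_m) (f : 'rV[R]_m -> R) q (t c e : R) :
  (forall s : R, `|s| <= `|t| -> derivable f (q + s *: delta_mx 0 k) (delta_mx 0 k)) ->
  (forall s : R, `|s| <= `|t| -> `|partial k f (q + s *: delta_mx 0 k) - c| <= e) ->
  `|f (q + t *: delta_mx 0 k) - f q - t * c| <= e * `|t|.
Proof.
move=> fd fe.
pose phi (s : R) := f (q + s *: delta_mx 0 k).
have dphi (s : R) : `|s| <= `|t| ->
    is_derive s (1 : R) phi (partial k f (q + s *: delta_mx 0 k)).
  move=> st.
  have E h : f (h *: delta_mx 0 k + (q + s *: delta_mx 0 k)) = phi (h + s).
    by rewrite /phi scalerDl addrCA addrA.
  have := fd s st; rewrite /partial /derivable /derive.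
  rewrite (_ : (fun h : R => h^-1 *: ((f \o shift (q + s *: delta_mx 0 k))
     (h *: delta_mx 0 k) - f (q + s *: delta_mx 0 k))) =
     (fun h : R => h^-1 *: ((phi \o shift s) (h *: 1) - phi s))); last first.
    by apply/funext => h /=; rewrite E [h *: 1]mulr1.
  by move=> H; split.
have [t0|t0|->] := ltgtP t 0; last first.
- by rewrite scale0r addr0 subrr mul0r subr0 normr0 mulr0.
- have [//|s||s] := @MVT _ phi (fun s => partial k f (q + s *: delta_mx 0 k)) 0 t.
  + rewrite in_itv/= => /andP[s0 st]; apply: dphi.
    by rewrite !gtr0_norm// ltW.
  + apply: derivable_within_continuous => s.
    rewrite in_itv/= => /andP[s0 st].
    have [|//] := dphi s; by rewrite !ger0_norm ?(ltW t0).
  + rewrite in_itv/= => /andP[s0 st].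
    rewrite /phi scale0r addr0 subr0 => ->.
    rewrite mulrC -mulrBr normrM mulrC ler_wpM2r//; apply: fe.
    by rewrite !ger0_norm ?(ltW t0)// ltW.
- have [//|s||s] := @MVT _ phi (fun s => partial k f (q + s *: delta_mx 0 k)) t 0.
  + rewrite in_itv/= => /andP[s0 st]; apply: dphi.
    by rewrite !ltr0_norm// lerN2 ltW.
  + apply: derivable_within_continuous => s.
    rewrite in_itv/= => /andP[s0 st].
    have [|//] := dphi s; by rewrite !ler0_norm ?(ltW t0)// lerN2.
  + rewrite in_itv/= => /andP[s0 st].
    rewrite /phi scale0r addr0 sub0r => E.
    rewrite -(opprB (f q)) E mulrN opprK mulrC -mulrBr normrM mulrC.
    rewrite ler_wpM2r//; apply: fe.
    by rewrite !ler0_norm ?(ltW t0)// ?lerN2// ltW.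
Qed.

Definition lincomb m (c : 'I_m -> R) (h : 'rV[R]_m) : R := \sum_k h 0 k * c k.

Lemma lincomb_is_linear m (c : 'I_m -> R) : linear (lincomb c).
Proof.
move=> a u v; rewrite /lincomb scaler_sumr -big_split; apply: eq_bigr => k _ /=.
by rewrite !mxE mulrDl -mulrA.
Qed.

HB.instance Definition _ m (c : 'I_m -> R) :=
  GRing.isLinear.Build R 'rV[R]_m R _ (lincomb c) (lincomb_is_linear c).

(** The increment from p to p + h is split along the staircase that changes one
    coordinate at a time.  Each step is controlled by [partial_increment], since
    in the sup norm the whole staircase stays in any ball around p that
    contains p + h. *)
Lemma C1_differentiable_aux m (f : 'rV[R]_m -> R) p :
  (\forall q \near p, forall k, derivable f q (delta_mx 0 k)) ->
  (forall k, {for p, continuous (partial k f)}) ->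
  continuous (lincomb (fun k => partial k f p)) /\
  f \o shift p = cst (f p) + lincomb (fun k => partial k f p) +o_ 0 id.
Proof.
move=> fd fc; split.
  move=> h; rewrite /continuous_at /lincomb /=.
  apply: (@cvg_sum_seq _ _ (nbhs_filter h)) => k _; apply: cvgM; last exact: cvg_cst.
  exact: coord_continuous.
apply/eqaddoP => e e0.
(* The error e is shared between the m steps; m + 1 keeps e1 positive for m = 0. *)
pose e1 := e / m.+1%:R.
have e10 : 0 < e1 by rewrite divr_gt0.
have : \forall q \near p, forall k, derivable f q (delta_mx 0 k) /\
    `|partial k f q - partial k f p| <= e1.
  apply: (@filter_forall _ _ (fun k q => derivable f q (delta_mx 0 k) /\
    `|partial k f q - partial k f p| <= e1) (nbhs p)) => k.
  near=> q; split; first by move: (k); near: q.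
  rewrite distrC; near: q.
  by move/cvgrPdist_le: (fc k) => /(_ _ e10).
move=> /nbhs_ballP[d /= d0 dP].
near=> h.
have hd : `|h| < d.
  near: h; apply/nbhs_ballP; exists d => // x.
  by rewrite -ball_normE /ball_ /= sub0r normrN.
(* The corners of the staircase: hh i has the first i coordinates of h. *)
pose hh i : 'rV[R]_m := \row_j (if (j < i)%N then h 0 j else 0).
have hhm : hh m = h by apply/rowP => j; rewrite mxE ltn_ord.
have hh0 : hh 0%N = 0 by apply/rowP => j; rewrite !mxE.
have hhS (i : 'I_m) : hh i.+1 = hh i + h 0 i *: delta_mx 0 i.
  apply/rowP => j; rewrite !mxE eqxx /= ltnS leq_eqVlt.
  have [->|ji] := eqVneq j i; first by rewrite eqxx ltnn add0r mulr1.
  by rewrite (negbTE (_ : (j != i :> nat)))// mulr0 addr0.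
rewrite /= -[X in X <= _]/(`|f (h + p) - (f p + lincomb (fun k => partial k f p) h)|).
have -> : f (h + p) - (f p + lincomb (fun k => partial k f p) h) =
   \sum_(i < m) (f (p + hh i.+1) - f (p + hh i) - h 0 i * partial i f p).
  rewrite sumrB -(big_mkord xpredT (fun i => f (p + hh i.+1) - f (p + hh i))).
  by rewrite telescope_sumr// hhm hh0 addr0 opprD addrA (addrC p).
apply: (le_trans (ler_norm_sum _ _ _)).
apply: (@le_trans _ _ (\sum_(i < m) e1 * `|h|)); last first.
  rewrite sumr_const card_ord -[_ *+ m]mulr_natr /e1.
  rewrite mulrAC ler_wpM2r// -mulrA ger_pMr// mulrC ler_pdivrMr// mul1r.
  by rewrite ler_nat.
apply: ler_sum => i _; rewrite hhS addrA.
apply: (@le_trans _ _ (e1 * `|h 0 i|)); last first.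
  by rewrite ler_wpM2l ?coord_le_norm// ltW.
have inb (s : R) : `|s| <= `|h 0 i| -> ball p d (p + hh i + s *: delta_mx 0 i).
  move=> sh; rewrite -ball_normE /ball_ /= -addrA opprD addNKr normrN.
  apply: le_lt_trans hd; apply: norm_le_coord => // k.
  rewrite !mxE eqxx /=; have [->|ki] := eqVneq k i.
    by rewrite ltnn add0r mulr1 (le_trans sh)// coord_le_norm.
  rewrite mulr0 addr0; case: ifP => _; last by rewrite normr0.
  exact: coord_le_norm.
by apply: partial_increment => s /inb /dP /(_ i) [].
Unshelve. all: by end_near. Qed.

Lemma C1_differentiable m (f : 'rV[R]_m -> R) p :
  (\forall q \near p, forall k, derivable f q (delta_mx 0 k)) ->
  (forall k, {for p, continuous (partial k f)}) ->
  differentiable f p /\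
  'd f p = lincomb (fun k => partial k f p) :> (_ -> _).
Proof.
move=> fd fc; have [c E] := C1_differentiable_aux fd fc.
have D := diff_unique c E; split => //.
by apply/diff_locallyP; rewrite D.
Qed.

End C1Differentiable.

(** * Finite orders of smoothness and the chain rule *)

Section Smoothness.
Context {R : realType}.

(** Restriction to the line through p in the direction v reduces this to the
    chain rule for differentials on the real line. *)
Lemma derivable_comp_diff m m' (f : 'rV[R]_m' -> R) (T : 'rV[R]_m -> 'rV[R]_m')
    p v :
  differentiable f (T p) -> derivable T p v ->
  derivable (f \o T) p v /\ 'D_v (f \o T) p = 'd f (T p) ('D_v T p).
Proof.
move=> df dT.
pose g (h : R) := T (h *: v + p).
have g0 : g 0 = T p by rewrite /g scale0r add0r.
have dg : differentiable g 0 by exact: (derivable1_diffP g 0).1 ((derivable1P _ _ _).1 dT).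
have dfg : differentiable f (g 0) by rewrite g0.
have dc : differentiable (f \o g) 0 by exact: differentiable_comp.
have E (W : normedModType R) (F : 'rV[R]_m -> W) :
    'D_v F p = 'D_1 (fun h : R => F (h *: v + p)) 0.
  rewrite /derive; set g1 := fun h => h^-1 *: _; set g2 := fun h => h^-1 *: _.
  suff -> : g1 = g2 by [].
  by apply/funext => h; rewrite /g1 /g2 /= addr0 scale0r add0r [h *: 1]mulr1.
split.
  exact: (derivable1P (f \o T) p v).2 ((derivable1_diffP (f \o g) 0).2 dc).
rewrite E (deriveE _ dc) diff_comp// g0 /=; congr ('d f _ _).
by rewrite E (deriveE _ dg).
Qed.

(** Smoothness up to order N, in recursive form: the derivative of a product or of
    a composite is a sum of products of functions already known at one order
    less, so the closure properties are inductions on N. *)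
Fixpoint Cn (N m : nat) (U : set 'rV[R]_m) (f : 'rV[R]_m -> R) : Prop :=
  (forall p, U p -> {for p, continuous f}) /\
  if N is N'.+1 then
    (forall k p, U p -> derivable f p (delta_mx 0 k)) /\
    forall k, Cn N' U (partial k f)
  else True.

Lemma smooth_on_partial m (U : set 'rV[R]_m) f k :
  smooth_on U f -> smooth_on U (partial k f).
Proof. by move=> sf s p Up; have := sf (rcons s k) p Up; rewrite foldr_rcons. Qed.

(** In [foldr partial f s] the last index of s is differentiated first, hence the
    induction on s from the right. *)
Lemma smooth_onP m (U : set 'rV[R]_m) f : smooth_on U f <-> forall N, Cn N U f.
Proof.
split=> [sf N|sf s p Up].
  elim: N f sf => [|N IH] f sf /=.
    by split => // p Up; exact: (sf [::] p Up).1.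
  split; first by move=> p Up; exact: (sf [::] p Up).1.
  split; first by move=> k p Up; exact: (sf [::] p Up).2.
  by move=> k; apply: IH; exact: smooth_on_partial.
elim/last_ind: s f sf => [|s k IH] f sf.
  split; first by have [/(_ p Up)] := sf 0%N.
  by move=> k; have [_ [/(_ k p Up)]] := sf 1%N.
rewrite foldr_rcons; apply: IH => N.
exact: (sf N.+1).2.2.
Qed.

Lemma Cn_cont N m (U : set 'rV[R]_m) f : Cn N U f ->
  forall p, U p -> {for p, continuous f}.
Proof. by case: N => [|N] []. Qed.

Lemma CnS N m (U : set 'rV[R]_m) f : Cn N.+1 U f -> Cn N U f.
Proof.
elim: N f => [|N IH] f; first by move=> [].
move=> [fc [fd fp]]; split => //; split => // k.
by apply: IH; exact: fp.
Qed.

Lemma near_open (T : topologicalType) (U : set T) (P : T -> Prop) p :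
  open U -> U p -> (forall q, U q -> P q) -> \forall q \near p, P q.
Proof. by move=> Uo Up UP; apply: filterS UP _; exact: open_nbhs_nbhs. Qed.

Lemma continuous_eq_open (T V : topologicalType) (U : set T) (u v : T -> V) p :
  open U -> U p -> (forall q, U q -> u q = v q) ->
  {for p, continuous u} -> {for p, continuous v}.
Proof.
move=> Uo Up uv uc; rewrite /prop_for /continuous_at -(uv _ Up).
apply: cvg_trans uc; apply: near_eq_cvg.
exact: (near_open Uo Up uv).
Qed.

Lemma Cn_eq N m (U : set 'rV[R]_m) f g : open U ->
  (forall p, U p -> f p = g p) -> Cn N U f -> Cn N U g.
Proof.
move=> Uo.
move: f g; elim: N => [|N IH] f g fg.
  by move=> [fc _]; split => // p Up; apply: (continuous_eq_open Uo Up fg); exact: fc.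
move=> [fc [fd fp]]; split.
  by move=> p Up; apply: (continuous_eq_open Uo Up fg); exact: fc.
split => [k p Up|k].
  by apply: near_eq_derivable (fd k p Up); exact: (near_open Uo Up fg).
apply: IH (fp k) => p Up; apply: near_eq_derive; exact: (near_open Uo Up fg).
Qed.

Lemma Cn_cst N m (U : set 'rV[R]_m) (c : R) : Cn N U (fun=> c).
Proof.
have cc (d : R) p : {for p, continuous (fun _ : 'rV[R]_m => d)}
  by exact: cst_continuous.
elim: N c => [|N IH] c; first by split.
split => //; split; first by move=> k p Up; exact: derivable_cst.
move=> k; rewrite (_ : partial k _ = fun=> 0)//.
by apply/funext => p; rewrite /partial derive_cst.
Qed.

Lemma Cn_add N m (U : set 'rV[R]_m) f g : open U ->
  Cn N U f -> Cn N U g -> Cn N U (fun p => f p + g p).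
Proof.
move=> Uo.
elim: N f g => [|N IH] f g.
  by move=> [fc _] [gc _]; split=> // p Up; exact: (continuousD (fc p Up) (gc p Up)).
move=> [fc [fd fp]] [gc [gd gp]]; split; last split.
- by move=> p Up; exact: (continuousD (fc p Up) (gc p Up)).
- by move=> k p Up; apply: derivableD; [exact: fd|exact: gd].
- move=> k; apply: (@Cn_eq _ _ _ (fun p => partial k f p + partial k g p)) => //.
    by move=> p Up; rewrite /partial -deriveD//; [exact: fd|exact: gd].
  by apply: IH; [exact: fp|exact: gp].
Qed.

Lemma partialM m (f g : 'rV[R]_m -> R) k p :
  derivable f p (delta_mx 0 k) -> derivable g p (delta_mx 0 k) ->
  partial k (fun q => f q * g q) p = partial k f p * g p + f p * partial k g p.
Proof.
move=> df dg; apply: etrans (deriveM df dg) _.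
by rewrite addrC -[_ *: 'D__ f p]/(_ * _) mulrC.
Qed.

Lemma Cn_mul N m (U : set 'rV[R]_m) f g : open U ->
  Cn N U f -> Cn N U g -> Cn N U (fun p => f p * g p).
Proof.
move=> Uo.
elim: N f g => [|N IH] f g.
  by move=> [fc _] [gc _]; split=> // p Up; exact: (continuousM (fc p Up) (gc p Up)).
move=> Cf Cg; have [fc [fd fp]] := Cf; have [gc [gd gp]] := Cg.
split; last split.
- by move=> p Up; exact: (continuousM (fc p Up) (gc p Up)).
- by move=> k p Up; apply: derivableM; [exact: fd|exact: gd].
- move=> k; apply: (@Cn_eq _ _ _
    (fun p => partial k f p * g p + f p * partial k g p)) => //.
    by move=> p Up; rewrite partialM//; [exact: fd|exact: gd].
  apply: (Cn_add Uo); first exact: IH (fp k) (CnS Cg).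
  exact: IH (CnS Cf) (gp k).
Qed.

Lemma Cn_sum N m (U : set 'rV[R]_m) I (r : seq I) (P : pred I)
    (f : I -> 'rV[R]_m -> R) : open U ->
  (forall i, P i -> Cn N U (f i)) -> Cn N U (fun p => \sum_(i <- r | P i) f i p).
Proof.
move=> Uo Cf; elim: r => [|i r IH].
  by under eq_fun do rewrite big_nil; exact: Cn_cst.
under eq_fun do rewrite big_cons.
by case: (boolP (P i)) => // Pi; apply: (Cn_add Uo) => //; exact: Cf.
Qed.

Lemma Cn_differentiable N m (U : set 'rV[R]_m) f p : open U -> Cn N.+1 U f ->
  U p -> differentiable f p /\
  'd f p = lincomb (fun k => partial k f p) :> (_ -> _).
Proof.
move=> Uo [fc [fd fp]] Up; apply: C1_differentiable; last first.
  by move=> k; exact: Cn_cont (fp k) _ Up.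
by apply: near_open Up _ => // q Uq k; exact: fd.
Qed.

Lemma partial_comp N m m' (V : set 'rV[R]_m') (f : 'rV[R]_m' -> R)
    (T : 'rV[R]_m -> 'rV[R]_m') p k :
  open V -> Cn N.+1 V f -> V (T p) ->
  (forall j, derivable (fun q => T q 0 j) p (delta_mx 0 k)) ->
  derivable (f \o T) p (delta_mx 0 k) /\
  partial k (f \o T) p =
    \sum_j partial k (fun q => T q 0 j) p * partial j f (T p).
Proof.
move=> Vo Cf VT dT.
have [df dfE] := Cn_differentiable Vo Cf VT.
have dT' : derivable T p (delta_mx 0 k).
  by apply/derivable_mxP => i j; rewrite ord1; exact: dT.
have [d1 d2] := derivable_comp_diff df dT'.
split => //; rewrite /partial d2 dfE /lincomb; apply: eq_bigr => j _.
by rewrite derive_mx// mxE.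
Qed.

Lemma rV_continuous (T : topologicalType) m (f : T -> 'rV[R]_m) p :
  (forall j, {for p, continuous (fun q => f q 0 j)}) -> {for p, continuous f}.
Proof.
move=> fc; apply/cvgrPdist_le => e e0.
have : \forall t \near p, forall j, `|f p 0 j - f t 0 j| <= e.
  apply: (@filter_forall _ _ (fun j t => `|f p 0 j - f t 0 j| <= e) (nbhs p)).
  by move=> j; move/cvgrPdist_le: (fc j); apply.
apply: filterS => t H; apply: norm_le_coord; first exact: ltW.
by move=> j; rewrite !mxE; exact: H.
Qed.

(** A function of one real variable is treated through the whole sequence of its
    successive derivatives, which spares a calculus of higher derivatives. *)
Definition derivative_tower (V : set R) (phi : nat -> R -> R) : Prop :=
  forall i x, V x -> is_derive x (1 : R) (phi i) (phi i.+1 x).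

Lemma derive_comp1 m (f : 'rV[R]_m -> R) (phi : R -> R) p v d :
  is_derive (f p) (1 : R) phi d -> derivable f p v ->
  derivable (phi \o f) p v /\ 'D_v (phi \o f) p = 'D_v f p * d.
Proof.
move=> [dphi phiE] df.
pose g (h : R) := f (h *: v + p).
have g0 : g 0 = f p by rewrite /g scale0r add0r.
have dg : differentiable g 0 by exact: (derivable1_diffP g 0).1 ((derivable1P _ _ _).1 df).
have dfg : differentiable phi (g 0) by rewrite g0; exact: (derivable1_diffP phi (f p)).1 dphi.
have dc : differentiable (phi \o g) 0 by exact: differentiable_comp.
have E (F : 'rV[R]_m -> R) :
    'D_v F p = 'D_1 (fun h : R => F (h *: v + p)) 0.
  rewrite /derive; set g1 := fun h => h^-1 *: _; set g2 := fun h => h^-1 *: _.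
  suff -> : g1 = g2 by [].
  by apply/funext => h; rewrite /g1 /g2 /= addr0 scale0r add0r [h *: 1]mulr1.
split.
  exact: (derivable1P (phi \o f) p v).2 ((derivable1_diffP (phi \o g) 0).2 dc).
rewrite E (deriveE _ dc) diff_comp// g0 /=.
have E1 : 'D_v f p = 'd g 0 (1 : R) := etrans (E f) (deriveE (1 : R) dg).
rewrite E1 -phiE -derive1E.
exact: (congr1 (fun F => F ('d g 0 (1 : R))) (deriv1E dphi)).
Qed.

(** All levels of the tower are handled at once, because the derivative of
    [phi i \o f] involves [phi i.+1 \o f]. *)
Lemma Cn_comp1 N m (U : set 'rV[R]_m) V (f : 'rV[R]_m -> R) phi : open U ->
  derivative_tower V phi -> (forall p, U p -> V (f p)) ->
  Cn N U f -> forall i, Cn N U (phi i \o f).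
Proof.
move=> Uo dphi UV.
have cont i p : U p -> {for p, continuous f} -> {for p, continuous (phi i \o f)}.
  move=> Up fc; apply: continuous_comp => //.
  have [d _] := dphi i _ (UV _ Up).
  by apply/differentiable_continuous/derivable1_diffP.
move=> Cf i; elim: N f UV cont Cf i => [|N IH] f UV cont Cf i.
  by split => // p Up; apply: cont => //; exact: Cn_cont Cf _ Up.
have [fc [fd fp]] := Cf.
split; first by move=> p Up; apply: cont => //; exact: fc.
split; first by move=> k p Up; exact: (derive_comp1 (dphi i _ (UV _ Up)) (fd k p Up)).1.
move=> k; apply: (@Cn_eq _ _ _ (fun p => partial k f p * (phi i.+1 \o f) p)) => //.
  by move=> p Up; rewrite /partial (derive_comp1 (dphi i _ (UV _ Up)) (fd k p Up)).2.
exact: (Cn_mul Uo (fp k) (IH f UV cont (CnS Cf) i.+1)).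
Qed.

End Smoothness.

(** * Closure properties of smooth functions *)

Section SmoothClosure.
Context {R : realType}.
Variables (m : nat) (U : set 'rV[R]_m).
Hypothesis Uo : open U.
Implicit Types f g : 'rV[R]_m -> R.

Lemma smooth_eq f g : (forall p, U p -> f p = g p) ->
  smooth_on U f -> smooth_on U g.
Proof. by move=> fg /smooth_onP Cf; apply/smooth_onP => N; exact: Cn_eq (Cf N). Qed.

Lemma smooth_cst c : smooth_on U (fun=> c).
Proof. by apply/smooth_onP => N; exact: Cn_cst. Qed.

Lemma smoothD f g : smooth_on U f -> smooth_on U g ->
  smooth_on U (fun p => f p + g p).
Proof.
move=> /smooth_onP Cf /smooth_onP Cg; apply/smooth_onP => N.
exact: Cn_add Uo (Cf N) (Cg N).
Qed.

Lemma smoothM f g : smooth_on U f -> smooth_on U g ->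
  smooth_on U (fun p => f p * g p).
Proof.
move=> /smooth_onP Cf /smooth_onP Cg; apply/smooth_onP => N.
exact: Cn_mul Uo (Cf N) (Cg N).
Qed.

Lemma smoothZ c f : smooth_on U f -> smooth_on U (fun p => c * f p).
Proof. exact: smoothM (smooth_cst c). Qed.

Lemma smoothN f : smooth_on U f -> smooth_on U (fun p => - f p).
Proof.
by move=> /(smoothZ (-1)); apply: smooth_eq => p _; rewrite mulN1r.
Qed.

Lemma smoothB f g : smooth_on U f -> smooth_on U g ->
  smooth_on U (fun p => f p - g p).
Proof. by move=> sf sg; exact: smoothD sf (smoothN sg). Qed.

Lemma smooth_sum I (r : seq I) (P : pred I) (f : I -> 'rV[R]_m -> R) :
  (forall i, P i -> smooth_on U (f i)) ->
  smooth_on U (fun p => \sum_(i <- r | P i) f i p).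
Proof.
move=> sf; apply/smooth_onP => N; apply: Cn_sum => // i Pi.
exact: ((smooth_onP _ _).1 (sf i Pi)).
Qed.

Lemma smooth_comp1 V phi f i : derivative_tower V phi ->
  (forall p, U p -> V (f p)) -> smooth_on U f -> smooth_on U (phi i \o f).
Proof.
move=> tphi UV /smooth_onP Cf; apply/smooth_onP => N.
exact: (Cn_comp1 Uo tphi UV (Cf N)).
Qed.

End SmoothClosure.

Section SmoothMisc.
Context {R : realType}.

Lemma smooth_sub m (U V : set 'rV[R]_m) f : U `<=` V ->
  smooth_on V f -> smooth_on U f.
Proof. by move=> UV sf s p /UV; exact: sf. Qed.

Lemma smooth_local m (U : set 'rV[R]_m) f :
  (forall p, U p -> exists (V : set 'rV[R]_m) g, [/\ open V, V p,
      (forall q, V q -> f q = g q) & smooth_on V g]) ->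
  smooth_on U f.
Proof.
move=> H s p /H [V [g [Vo Vp fg sg]]].
by apply: (smooth_eq Vo (f := g)) => // q Vq; rewrite fg.
Qed.

Lemma smooth_continuous m (U : set 'rV[R]_m) f p :
  smooth_on U f -> U p -> {for p, continuous f}.
Proof. by move=> sf Up; exact: (sf [::] p Up).1. Qed.

Lemma smooth_derivable m (U : set 'rV[R]_m) f p k :
  smooth_on U f -> U p -> derivable f p (delta_mx 0 k).
Proof. by move=> sf Up; exact: (sf [::] p Up).2. Qed.

Lemma partial_coord m (k j : 'I_m) :
  partial k (fun q : 'rV[R]_m => q 0 j) = fun=> (j == k)%:R.
Proof.
apply/funext => p; rewrite /partial.
have D : differentiable (fun q : 'rV[R]_m => q 0 j) p.
  exact: differentiable_coord.
have L : linear (fun q : 'rV[R]_m => q 0 j : R) by move=> a u v; rewrite !mxE.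
pose g : {linear 'rV[R]_m -> R} :=
  HB.pack (fun q : 'rV[R]_m => q 0 j : R) (GRing.isLinear.Build R _ _ _ _ L).
rewrite deriveE// -[X in 'd X p]/(g : _ -> _) diff_lin; last exact: coord_continuous.
by rewrite /= mxE eqxx /=.
Qed.

Lemma smooth_coord m (U : set 'rV[R]_m) j : open U ->
  smooth_on U (fun q : 'rV[R]_m => q 0 j).
Proof.
move=> Uo; apply/smooth_onP => -[|N].
  by split => // p _; exact: coord_continuous.
split; first by move=> p _; exact: coord_continuous.
split; first by move=> k p _; apply: diff_derivable; exact: differentiable_coord.
by move=> k; rewrite partial_coord; exact: Cn_cst.
Qed.

Lemma tower_exp : derivative_tower [set: R] (fun=> expR).
Proof. by move=> i x _; exact: is_derive_expR. Qed.

Definition inv_tower (i : nat) (x : R) : R := (-1) ^+ i * i`!%:R * (x^-1) ^+ i.+1.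

Lemma tower_inv : derivative_tower [set x : R | x != 0] inv_tower.
Proof.
move=> i x x0; rewrite /inv_tower.
have dinv : is_derive x (1 : R) (fun y : R => y^-1) (- (x^-1) ^+ 2).
  have := @is_deriveV _ (id : R -> R) x 1 1 x0 (is_derive_id x (1 : R)).
  by move/is_derive_eq; apply; rewrite [_ *: _]mulr1 exprVn.
have dpow : is_derive (x^-1) (1 : R) (fun y : R => y ^+ i.+1)
    (i.+1%:R * (x^-1) ^+ i).
  apply: DeriveDef; first exact: exprn_derivable.
  by rewrite exp_derive [_ *: 1]mulr1.
have d := is_deriveZ ((-1) ^+ i * i`!%:R) (@is_derive1_comp R _ _ x _ _ dpow dinv).
have -> : (-1) ^+ i.+1 * i.+1`!%:R * (x^-1) ^+ i.+2 =
    ((-1) ^+ i * i`!%:R) *: (i.+1%:R * (x^-1) ^+ i * - (x^-1) ^+ 2).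
  by rewrite -![_ *: _]/(_ * _) factS natrM !exprS; ring.
exact: d.
Qed.

Definition ln_tower (i : nat) : R -> R := if i is j.+1 then inv_tower j else @ln R.

Lemma tower_ln : derivative_tower [set x : R | 0 < x] ln_tower.
Proof.
move=> [|i] x /= x0; last by apply: tower_inv; rewrite /= gt_eqF.
by rewrite /inv_tower expr0 fact0 !mul1r expr1; exact: is_derive1_ln.
Qed.

Lemma smooth_exp m (U : set 'rV[R]_m) f : open U -> smooth_on U f ->
  smooth_on U (fun p => expR (f p)).
Proof. by move=> Uo sf; exact: (smooth_comp1 Uo 0 tower_exp (fun _ _ => I) sf). Qed.

Lemma smoothV m (U : set 'rV[R]_m) f : open U -> (forall p, U p -> f p != 0) ->
  smooth_on U f -> smooth_on U (fun p => (f p)^-1).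
Proof.
move=> Uo f0 sf; apply: (smooth_eq Uo (f := inv_tower 0 \o f)).
  by move=> p Up; rewrite /= /inv_tower expr0 fact0 !mul1r expr1.
exact: (smooth_comp1 Uo 0 tower_inv f0 sf).
Qed.

Lemma smooth_ln m (U : set 'rV[R]_m) f : open U -> (forall p, U p -> 0 < f p) ->
  smooth_on U f -> smooth_on U (fun p => ln (f p)).
Proof. by move=> Uo f0 sf; exact: (smooth_comp1 Uo 0 tower_ln f0 sf). Qed.

End SmoothMisc.

(** * A smooth function flat at the origin *)

Section FlatExponential.
Context {R : realType}.
Implicit Types (p : {poly R}) (x y : R).

(** The functions p(1/x) exp(-1/x) for x > 0, extended by 0.  As p varies they
    form a family closed under differentiation, so that one computation of a
    first derivative yields the smoothness of exp(-1/x) at the origin. *)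
Definition flat p x : R := if 0 < x then p.[x^-1] * expR (- x^-1) else 0.

Lemma flat_pos p x : 0 < x -> flat p x = p.[x^-1] * expR (- x^-1).
Proof. by rewrite /flat => ->. Qed.

Lemma flat_neg p x : x <= 0 -> flat p x = 0.
Proof. by rewrite /flat ltNge => ->. Qed.

(** exp y is the power of exponent n + 1 of exp (y / (n + 1)), and the latter is
    larger than y / (n + 1). *)
Lemma expr_expRN_bound (n : nat) y : 0 < y ->
  y ^+ n * expR (- y) <= n.+1%:R ^+ n.+1 / y.
Proof.
move=> y0; rewrite expRN ler_pdivlMr// mulrAC ler_pdivrMr ?expR_gt0//.
rewrite -exprSr -[X in expR X](@divfK _ n.+1%:R)// [X in expR X]mulrC.
rewrite expRM_natl -exprMn lerXn2r ?nnegrE ?mulr_ge0 ?expR_ge0 ?(ltW y0)//.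
rewrite -ler_pdivrMl// mulrC.
by apply: le_trans (expR_ge1Dx _); rewrite lerDr.
Qed.

(** A bound linear in x, valid for every p, gives the derivative 0 at the origin
    when it is applied to 'X * p: dividing [flat p x] by x gives
    [flat ('X * p) x]. *)
Lemma flat_bound p : exists2 C, 0 <= C & forall x, `|flat p x| <= C * `|x|.
Proof.
pose C := \sum_(i < size p) `|p`_i| * i.+1%:R ^+ i.+1 : R.
have C0 : 0 <= C by apply: sumr_ge0 => i _; rewrite mulr_ge0// exprn_ge0.
exists C => // x; have [x0|x0] := ltP 0 x; last first.
  by rewrite flat_neg// normr0 mulr_ge0.
rewrite flat_pos// horner_coef mulr_suml mulr_suml.
apply: le_trans (ler_norm_sum _ _ _) _; apply: ler_sum => i _.
rewrite -mulrA normrM -[leRHS]mulrA ler_wpM2l//.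
rewrite ger0_norm ?mulr_ge0 ?exprn_ge0 ?expR_ge0 ?invr_ge0 ?(ltW x0)//.
apply: le_trans (expr_expRN_bound _ _) _; first by rewrite invr_gt0.
by rewrite invrK gtr0_norm.
Qed.

(** The polynomial q such that q(1/x) exp(-1/x) is the derivative of
    p(1/x) exp(-1/x). *)
Definition flat_next p : {poly R} := 'X^2 * (p - p^`()).

Lemma flat_derive p x : is_derive x (1 : R) (flat p) (flat (flat_next p) x).
Proof.
have [x0|x0|->] := ltgtP x 0.
- rewrite flat_neg ?ltW//.
  apply: (@near_eq_is_derive R R R (cst (0 : R))).
  near=> y; rewrite flat_neg//; apply: ltW; near: y; exact: lt_nbhsl.
- rewrite flat_pos//.
  apply: (@near_eq_is_derive R R R (fun y : R => p.[y^-1] * expR (- y^-1))).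
    near=> y; rewrite flat_pos//; near: y; exact: lt_nbhsr.
  have dinv : is_derive x (1 : R) (fun y : R => y^-1) (- (x^-1) ^+ 2).
    have := @is_deriveV _ (id : R -> R) x 1 1 _ (is_derive_id x (1 : R)).
    move=> /(_ (lt0r_neq0 x0))/is_derive_eq; apply.
    by rewrite [_ *: _]mulr1 exprVn.
  have d1 := @is_derive1_comp R (horner p) (fun y => y^-1) x _ _
    (is_derive_poly p x^-1) dinv.
  have d2 := @is_derive1_comp R (@expR R) (fun y => - y^-1) x _ _
    (is_derive_expR _) (is_deriveN dinv).
  have d := is_deriveM d1 d2.
  apply: (is_derive_eq d).
  rewrite -![_ *: _]/(_ * _) /flat_next !hornerE /=.
  by ring.
- rewrite flat_neg//.
  have [C C0 HC] := flat_bound ('X * p).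
  have L : h^-1 *: ((flat p \o shift 0) (h *: 1) - flat p 0) @[h --> 0^'] --> (0 : R).
    apply/cvgr0Pnorm_le => e e0.
    near=> h.
    have h0 : h != 0 by near: h; exact: nbhs_dnbhs_neq.
    rewrite /= addr0 [h *: 1]mulr1 (@flat_neg p 0)// subr0 -[_ *: _]/(_ * _).
    have -> : h^-1 * flat p h = flat ('X * p) h.
      by rewrite /flat; case: ifP => _; rewrite ?mulr0// hornerM hornerX mulrA.
    apply: le_trans (HC h) _.
    apply: (@le_trans _ _ ((C + 1) * `|h|)); first by rewrite ler_wpM2r// lerDl.
    rewrite -ler_pdivlMl ?ltr_wpDl//; apply: ltW; near: h.
    apply: dnbhs0_lt; rewrite mulr_gt0// invr_gt0 ltr_wpDl//.
  by apply: DeriveDef; [apply/cvg_ex; exists 0|exact/cvg_lim].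
Unshelve. all: by end_near. Qed.

Lemma flat_tower p : derivative_tower [set: R] (fun i => flat (iter i flat_next p)).
Proof. by move=> i x _; exact: flat_derive. Qed.

Definition bump_profile : R -> R := flat 1.

Lemma smooth_profile m (U : set 'rV[R]_m) f : open U -> smooth_on U f ->
  smooth_on U (fun q => bump_profile (f q)).
Proof. by move=> Uo sf; exact: (smooth_comp1 Uo 0 (flat_tower 1) (fun _ _ => I) sf). Qed.

Lemma profile_gt0 x : (0 < bump_profile x) = (0 < x).
Proof.
rewrite /bump_profile; have [x0|x0] := ltP 0 x; last by rewrite flat_neg// ltxx.
by rewrite flat_pos// hornerE mul1r expR_gt0.
Qed.

Lemma profile_ge0 x : 0 <= bump_profile x.
Proof.
have [x0|x0] := ltP 0 x; first by rewrite ltW// profile_gt0.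
by rewrite /bump_profile flat_neg.
Qed.

Lemma profile_le x y : x <= y -> bump_profile x <= bump_profile y.
Proof.
move=> xy; have [x0|x0] := ltP 0 x; last by rewrite [leLHS]flat_neg// profile_ge0.
rewrite /bump_profile !flat_pos ?(lt_le_trans x0)// !hornerE ?mul1r.
by rewrite ler_expR lerN2 lef_pV2// posrE (lt_le_trans x0).
Qed.

Lemma profile_lt x y : bump_profile y < bump_profile x -> y < x.
Proof. by apply: contraTT; rewrite -!leNgt; exact: profile_le. Qed.

Lemma profile_strict x y : 0 < y -> x < y -> bump_profile x < bump_profile y.
Proof.
move=> y0 xy; have [x0|x0] := ltP 0 x; last first.
  by rewrite [ltLHS]flat_neg// profile_gt0.
rewrite /bump_profile !flat_pos// !hornerE ?mul1r.
by rewrite ltr_expR ltrN2 ltf_pV2// posrE.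
Qed.

Lemma profile_le1 x : bump_profile x <= 1.
Proof.
have [x0|x0] := ltP 0 x; last by rewrite [leLHS]flat_neg.
rewrite /bump_profile flat_pos// hornerE mul1r -expR0 ler_expR.
by rewrite oppr_le0 invr_ge0 ltW.
Qed.

Lemma profile_derive_gt0 x : 0 < x -> 0 < flat (flat_next 1) x.
Proof.
move=> x0; rewrite flat_pos// mulr_gt0 ?expR_gt0// /flat_next -polyC1 derivC subr0.
by rewrite !hornerE exprn_gt0// invr_gt0.
Qed.

End FlatExponential.

(** * Smooth complex-valued functions *)

Section ComplexSmooth.
Context {R : realType}.
Variables (m : nat) (U : set 'rV[R]_m).
Hypothesis Uo : open U.
Implicit Types f g : 'rV[R]_m -> R[i].

Lemma csmooth_eq f g : (forall p, U p -> f p = g p) ->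
  csmooth_on U f -> csmooth_on U g.
Proof.
move=> fg [sr si]; split; [apply: smooth_eq sr => // |apply: smooth_eq si => //];
  by move=> p Up /=; rewrite fg.
Qed.

Lemma csmooth_cst c : csmooth_on U (fun=> c).
Proof. by split; exact: smooth_cst. Qed.

Lemma ReD (x y : R[i]) : complex.Re (x + y) = complex.Re x + complex.Re y.
Proof. by case: x y => [a b] [c d]. Qed.
Lemma ImD (x y : R[i]) : complex.Im (x + y) = complex.Im x + complex.Im y.
Proof. by case: x y => [a b] [c d]. Qed.
Lemma ReM (x y : R[i]) : complex.Re (x * y) =
  complex.Re x * complex.Re y - complex.Im x * complex.Im y.
Proof. by case: x y => [a b] [c d]. Qed.
Lemma ImM (x y : R[i]) : complex.Im (x * y) =
  complex.Re x * complex.Im y + complex.Im x * complex.Re y.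
Proof. by case: x y => [a b] [c d]. Qed.
Lemma ReJ (x : R[i]) : complex.Re (Num.conj x) = complex.Re x.
Proof. by case: x. Qed.
Lemma ImJ (x : R[i]) : complex.Im (Num.conj x) = - complex.Im x.
Proof. by case: x. Qed.

Lemma csmoothD f g : csmooth_on U f -> csmooth_on U g ->
  csmooth_on U (fun p => f p + g p).
Proof.
move=> [fr fi] [gr gi]; split.
  by apply: (smooth_eq Uo _ (smoothD Uo fr gr)) => p _; rewrite ReD.
by apply: (smooth_eq Uo _ (smoothD Uo fi gi)) => p _; rewrite ImD.
Qed.

Lemma csmoothM f g : csmooth_on U f -> csmooth_on U g ->
  csmooth_on U (fun p => f p * g p).
Proof.
move=> [fr fi] [gr gi]; split.
  apply: (smooth_eq Uo _ (smoothB Uo (smoothM Uo fr gr) (smoothM Uo fi gi))).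
  by move=> p _; rewrite ReM.
apply: (smooth_eq Uo _ (smoothD Uo (smoothM Uo fr gi) (smoothM Uo fi gr))).
by move=> p _; rewrite ImM.
Qed.

Lemma csmooth_real (f : 'rV[R]_m -> R) : smooth_on U f ->
  csmooth_on U (fun p => (f p)%:C).
Proof. by move=> sf; split; [exact: sf|exact: smooth_cst]. Qed.

Lemma csmoothN f : csmooth_on U f -> csmooth_on U (fun p => - f p).
Proof.
move=> sf; apply: csmooth_eq (csmoothM (csmooth_cst (-1)) sf) => p _.
by rewrite mulN1r.
Qed.

Lemma csmooth_conj f : csmooth_on U f -> csmooth_on U (fun p => Num.conj (f p)).
Proof.
move=> [fr fi]; split.
  by apply: (smooth_eq Uo _ fr) => p _; rewrite ReJ.
by apply: (smooth_eq Uo _ (smoothN Uo fi)) => p _; rewrite ImJ.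
Qed.

Lemma csmooth_sum I (r : seq I) (P : pred I) (f : I -> 'rV[R]_m -> R[i]) :
  (forall i, P i -> csmooth_on U (f i)) ->
  csmooth_on U (fun p => \sum_(i <- r | P i) f i p).
Proof.
move=> sf; elim: r => [|i r IH].
  by under eq_fun do rewrite big_nil; exact: csmooth_cst.
under eq_fun do rewrite big_cons.
case: (boolP (P i)) => Pi; [exact: (csmoothD (sf i Pi) IH)|exact: IH].
Qed.

Lemma csmooth_prod I (r : seq I) (P : pred I) (f : I -> 'rV[R]_m -> R[i]) :
  (forall i, P i -> csmooth_on U (f i)) ->
  csmooth_on U (fun p => \prod_(i <- r | P i) f i p).
Proof.
move=> sf; elim: r => [|i r IH].
  by under eq_fun do rewrite big_nil; exact: csmooth_cst.
under eq_fun do rewrite big_cons.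
case: (boolP (P i)) => Pi; [exact: (csmoothM (sf i Pi) IH)|exact: IH].
Qed.

Lemma csmoothV f : (forall p, U p -> f p != 0) -> csmooth_on U f ->
  csmooth_on U (fun p => (f p)^-1).
Proof.
move=> f0 [fr fi].
pose N p := complex.Re (f p) * complex.Re (f p) + complex.Im (f p) * complex.Im (f p).
have N0 p : U p -> N p != 0.
  move=> /f0; apply: contraNneq; rewrite /N -!expr2 => /eqP.
  rewrite paddr_eq0 ?sqr_ge0// !sqrf_eq0 => /andP[/eqP r0 /eqP i0].
  by apply/eqP; case: (f p) r0 i0 => a b /= -> ->.
have sN : smooth_on U N by exact: (smoothD Uo (smoothM Uo fr fr) (smoothM Uo fi fi)).
apply: csmooth_eq (csmoothM (csmooth_conj (conj fr fi))
   (csmooth_real (smoothV Uo N0 sN))) => p Up.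
rewrite /N; case: (f p) => a b /=; rewrite -!expr2.
by apply/eqP; rewrite eq_complex /= !mulr0 subr0 add0r mulNr !eqxx.
Qed.

Lemma csmooth_cpartial k f : csmooth_on U f -> csmooth_on U (cpartial k f).
Proof. by move=> [fr fi]; split; exact: smooth_on_partial. Qed.

Lemma csmooth_det n (A : 'rV[R]_m -> 'M[R[i]]_n) :
  (forall i j, csmooth_on U (fun p => A p i j)) -> csmooth_on U (fun p => \det (A p)).
Proof.
move=> sA; apply: csmooth_sum => s _; apply: csmoothM; first exact: csmooth_cst.
by apply: csmooth_prod => i _.
Qed.

Lemma csmooth_mulmx a b c (A : 'rV[R]_m -> 'M[R[i]]_(a, b))
    (B : 'rV[R]_m -> 'M[R[i]]_(b, c)) :
  (forall i j, csmooth_on U (fun p => A p i j)) ->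
  (forall i j, csmooth_on U (fun p => B p i j)) ->
  forall i j, csmooth_on U (fun p => (A p *m B p) i j).
Proof.
move=> sA sB i j; under eq_fun do rewrite mxE.
by apply: csmooth_sum => k _; exact: (csmoothM (sA i k) (sB k j)).
Qed.

Lemma csmooth_invmx n (A : 'rV[R]_m -> 'M[R[i]]_n) :
  (forall p, U p -> \det (A p) != 0) ->
  (forall i j, csmooth_on U (fun p => A p i j)) ->
  forall i j, csmooth_on U (fun p => invmx (A p) i j).
Proof.
move=> dA sA i j.
have sadj : csmooth_on U (fun p => cofactor (A p) j i).
  rewrite /cofactor; apply: csmoothM; first exact: csmooth_cst.
  apply: csmooth_det => k l; under eq_fun do rewrite !mxE.
  exact: sA.
apply: csmooth_eq (csmoothM (csmoothV dA (csmooth_det sA)) sadj) => p Up.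
by rewrite /invmx unitmxE unitfE dA// !mxE.
Qed.

End ComplexSmooth.

(** * Wirtinger derivatives *)

Section Wirtinger.
Context {R : realType}.

Definition cderivable m (f : 'rV[R]_m -> R[i]) p : Prop := forall k,
  derivable (fun q => complex.Re (f q)) p (delta_mx 0 k) /\
  derivable (fun q => complex.Im (f q)) p (delta_mx 0 k).

Lemma csmooth_cderivable m (U : set 'rV[R]_m) f p :
  csmooth_on U f -> U p -> cderivable f p.
Proof.
by move=> [fr fi] Up k; split; [exact: smooth_derivable fr Up|exact: smooth_derivable fi Up].
Qed.

Lemma cpartial_eq m (U : set 'rV[R]_m) f g p k : open U -> U p ->
  (forall q, U q -> f q = g q) -> cpartial k f p = cpartial k g p.
Proof.
move=> Uo Up fg; rewrite /cpartial /partial; congr (_ +i* _); apply: near_eq_derive;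
  by apply: (near_open Uo Up) => q Uq /=; rewrite fg.
Qed.

Lemma cpartialD m (f g : 'rV[R]_m -> R[i]) p k :
  cderivable f p -> cderivable g p ->
  cpartial k (fun q => f q + g q) p = cpartial k f p + cpartial k g p.
Proof.
move=> /(_ k)[fr fi] /(_ k)[gr gi]; rewrite /cpartial.
under [X in partial k X]eq_fun do rewrite ReD.
under [X in _ +i* partial k X _]eq_fun do rewrite ImD.
by rewrite /partial; congr (_ +i* _); exact: deriveD.
Qed.

Lemma cpartialM m (f g : 'rV[R]_m -> R[i]) p k :
  cderivable f p -> cderivable g p ->
  cpartial k (fun q => f q * g q) p = cpartial k f p * g p + f p * cpartial k g p.
Proof.
move=> /(_ k)[fr fi] /(_ k)[gr gi]; rewrite /cpartial.
under [X in partial k X]eq_fun do rewrite ReM.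
under [X in _ +i* partial k X _]eq_fun do rewrite ImM.
pose pf (h : 'rV[R]_m -> R) := partial k h p.
have E1 : pf (fun q => complex.Re (f q) * complex.Re (g q) -
                       complex.Im (f q) * complex.Im (g q)) =
    pf (fun q => complex.Re (f q) * complex.Re (g q)) -
    pf (fun q => complex.Im (f q) * complex.Im (g q)).
  exact: deriveB (derivableM fr gr) (derivableM fi gi).
have E2 : pf (fun q => complex.Re (f q) * complex.Im (g q) +
                       complex.Im (f q) * complex.Re (g q)) =
    pf (fun q => complex.Re (f q) * complex.Im (g q)) +
    pf (fun q => complex.Im (f q) * complex.Re (g q)).
  exact: deriveD (derivableM fr gi) (derivableM fi gr).
rewrite -!/(pf _) E1 E2 {E1 E2}.
rewrite {1 2 3 4}/pf (partialM fr gr) (partialM fi gi) (partialM fr gi) (partialM fi gr).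
rewrite -!/(pf _); set x := pf _; set y := pf _; set z := pf _; set t := pf _.
case: (f p) (g p) => a b [c d] /=.
by apply/eqP; rewrite eq_complex /=; apply/andP; split; apply/eqP; ring.
Qed.

Lemma cpartial_conj m (f : 'rV[R]_m -> R[i]) p k : cderivable f p ->
  cpartial k (fun q => Num.conj (f q)) p = Num.conj (cpartial k f p).
Proof.
move=> /(_ k)[fr fi]; rewrite /cpartial.
under [X in partial k X]eq_fun do rewrite ReJ.
under [X in _ +i* partial k X _]eq_fun do rewrite ImJ.
by rewrite /partial deriveN.
Qed.

Lemma cpartial_cst m (c : R[i]) p (k : 'I_m) :
  cpartial k (fun=> c) p = 0.
Proof. by rewrite /cpartial /partial !derive_cst. Qed.

Lemma cderivable_cst m (c : R[i]) (p : 'rV[R]_m) : cderivable (fun=> c) p.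
Proof. by move=> k; split; exact: derivable_cst. Qed.

Lemma cderivableM m (f g : 'rV[R]_m -> R[i]) p :
  cderivable f p -> cderivable g p -> cderivable (fun q => f q * g q) p.
Proof.
move=> df dg k; have [fr fi] := df k; have [gr gi] := dg k; split.
  under eq_fun do rewrite ReM.
  exact: derivableB (derivableM fr gr) (derivableM fi gi).
under eq_fun do rewrite ImM.
exact: derivableD (derivableM fr gi) (derivableM fi gr).
Qed.

Lemma cderivableD m (f g : 'rV[R]_m -> R[i]) p :
  cderivable f p -> cderivable g p -> cderivable (fun q => f q + g q) p.
Proof.
move=> df dg k; have [fr fi] := df k; have [gr gi] := dg k; split.
  under eq_fun do rewrite ReD.
  exact: derivableD fr gr.
under eq_fun do rewrite ImD.
exact: derivableD fi gi.
Qed.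

Lemma cderivable_conj m (f : 'rV[R]_m -> R[i]) p :
  cderivable f p -> cderivable (fun q => Num.conj (f q)) p.
Proof.
move=> df k; have [fr fi] := df k; split.
  exact: (eq_rect _ (fun h => derivable h p _) fr _ (funext (fun q => esym (ReJ (f q))))).
under eq_fun do rewrite ImJ.
exact: derivableN fi.
Qed.

Lemma conj_i : Num.conj ('i : R[i]) = - 'i.
Proof. by apply/eqP; rewrite eq_complex /= oppr0 !eqxx. Qed.

Lemma conj_half (z : R[i]) : Num.conj (z / 2) = Num.conj z / 2.
Proof. by rewrite rmorphM fmorphV rmorph_nat. Qed.

(** The linearity and Leibniz rules for Wirtinger derivatives are consequences of
    those for real partial derivatives by the following identities, in which h
    stands for 1/2 and e for the imaginary unit. *)
Section FieldIdentities.
Variable F : comRingType.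
Implicit Types e h a b c d x y : F.

Lemma half_diffD e h a b c d :
  (a + c - e * (b + d)) * h = (a - e * b) * h + (c - e * d) * h.
Proof. by ring. Qed.
Lemma half_sumD e h a b c d :
  (a + c + e * (b + d)) * h = (a + e * b) * h + (c + e * d) * h.
Proof. by ring. Qed.
Lemma half_diffM e h a b c d x y :
  (a * y + x * c - e * (b * y + x * d)) * h =
  (a - e * b) * h * y + x * ((c - e * d) * h).
Proof. by ring. Qed.
Lemma half_diff_scale e h a b d :
  (a * d - e * (b * d)) * h = (a - e * b) * h * d.
Proof. by ring. Qed.
Lemma half_sum_lin d e h a b :
  (d * a + e * (d * b)) * h = d * ((a + e * b) * h).
Proof. by ring. Qed.
Lemma half_sumM e h a b c d x y :
  (a * y + x * c + e * (b * y + x * d)) * h =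
  (a + e * b) * h * y + x * ((c + e * d) * h).
Proof. by ring. Qed.

(** With x and y the partial derivatives along the real and imaginary axes: if the
    antiholomorphic derivative vanishes, both are determined by the holomorphic
    derivative. *)
Lemma hol_half (K : numFieldType) (i x y : K) : i ^+ 2 = -1 ->
  (x + i * y) / 2 = 0 -> x = (x - i * y) / 2 /\ y = i * ((x - i * y) / 2).
Proof.
move=> i2 /eqP; rewrite mulf_eq0 invr_eq0 pnatr_eq0 orbF addr_eq0 => /eqP ->.
split; first by field.
rewrite (_ : i * _ = - i ^+ 2 * y); last by field.
by rewrite i2 opprK mul1r.
Qed.
End FieldIdentities.

Section Rules.
Variables (n : nat) (p : 'rV[R]_(n + n)).
Implicit Types f g : 'rV[R]_(n + n) -> R[i].

Lemma dz_eq (U : set 'rV[R]_(n + n)) f g k : open U -> U p ->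
  (forall q, U q -> f q = g q) -> dz k f p = dz k g p.
Proof. by move=> Uo Up fg; rewrite /dz !(cpartial_eq _ Uo Up fg). Qed.

Lemma dzbar_eq (U : set 'rV[R]_(n + n)) f g k : open U -> U p ->
  (forall q, U q -> f q = g q) -> dzbar k f p = dzbar k g p.
Proof. by move=> Uo Up fg; rewrite /dzbar !(cpartial_eq _ Uo Up fg). Qed.

Lemma dzD f g k : cderivable f p -> cderivable g p ->
  dz k (fun q => f q + g q) p = dz k f p + dz k g p.
Proof. by move=> df dg; rewrite /dz !cpartialD//; exact: half_diffD. Qed.

Lemma dzbarD f g k : cderivable f p -> cderivable g p ->
  dzbar k (fun q => f q + g q) p = dzbar k f p + dzbar k g p.
Proof. by move=> df dg; rewrite /dzbar !cpartialD//; exact: half_sumD. Qed.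

Lemma dzM f g k : cderivable f p -> cderivable g p ->
  dz k (fun q => f q * g q) p = dz k f p * g p + f p * dz k g p.
Proof. by move=> df dg; rewrite /dz !cpartialM//; exact: half_diffM. Qed.

Lemma dzbarM f g k : cderivable f p -> cderivable g p ->
  dzbar k (fun q => f q * g q) p = dzbar k f p * g p + f p * dzbar k g p.
Proof. by move=> df dg; rewrite /dzbar !cpartialM//; exact: half_sumM. Qed.

Lemma dz_cst (c : R[i]) k : dz k (fun=> c) p = 0.
Proof. by rewrite /dz !cpartial_cst mulr0 subr0 mul0r. Qed.

Lemma dzbar_cst (c : R[i]) k : dzbar k (fun=> c) p = 0.
Proof. by rewrite /dzbar !cpartial_cst mulr0 addr0 mul0r. Qed.

Lemma dzbar_conj f k : cderivable f p ->
  dzbar k (fun q => Num.conj (f q)) p = Num.conj (dz k f p).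
Proof.
move=> df; rewrite /dzbar /dz !cpartial_conj// conj_half rmorphB rmorphM /= conj_i.
by rewrite mulNr opprK.
Qed.

Lemma dzZ (c : R[i]) f k : cderivable f p ->
  dz k (fun q => c * f q) p = c * dz k f p.
Proof. by move=> df; rewrite (dzM k (cderivable_cst c p) df) dz_cst mul0r add0r. Qed.

Lemma dzbarZ (c : R[i]) f k : cderivable f p ->
  dzbar k (fun q => c * f q) p = c * dzbar k f p.
Proof. by move=> df; rewrite (dzbarM k (cderivable_cst c p) df) dzbar_cst mul0r add0r. Qed.

Lemma cderivable_sum I (r : seq I) (f : I -> 'rV[R]_(n + n) -> R[i]) :
  (forall i, cderivable (f i) p) -> cderivable (fun q => \sum_(i <- r) f i q) p.
Proof.
move=> df; elim: r => [|i r IH].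
  under eq_fun do rewrite big_nil; exact: cderivable_cst.
under eq_fun do rewrite big_cons.
exact: (cderivableD (df i) IH).
Qed.

Lemma dz_sum I (r : seq I) (f : I -> 'rV[R]_(n + n) -> R[i]) k :
  (forall i, cderivable (f i) p) ->
  dz k (fun q => \sum_(i <- r) f i q) p = \sum_(i <- r) dz k (f i) p.
Proof.
move=> df; elim: r => [|i r IH].
  by under eq_fun do rewrite big_nil; rewrite big_nil dz_cst.
under eq_fun do rewrite big_cons.
by rewrite big_cons dzD ?IH//; exact: cderivable_sum.
Qed.

Lemma dzbar_sum I (r : seq I) (f : I -> 'rV[R]_(n + n) -> R[i]) k :
  (forall i, cderivable (f i) p) ->
  dzbar k (fun q => \sum_(i <- r) f i q) p = \sum_(i <- r) dzbar k (f i) p.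
Proof.
move=> df; elim: r => [|i r IH].
  by under eq_fun do rewrite big_nil; rewrite big_nil dzbar_cst.
under eq_fun do rewrite big_cons.
by rewrite big_cons dzbarD ?IH//; exact: cderivable_sum.
Qed.

End Rules.

Lemma csmooth_dz n (U : set 'rV[R]_(n + n)) f k : open U ->
  csmooth_on U f -> csmooth_on U (dz k f).
Proof.
move=> Uo sf.
have c d : csmooth_on U (fun=> d) by exact: csmooth_cst.
exact: (csmoothM Uo (csmoothD Uo (csmooth_cpartial _ sf)
  (csmoothN Uo (csmoothM Uo (c _) (csmooth_cpartial _ sf)))) (c _)).
Qed.

Lemma csmooth_dzbar n (U : set 'rV[R]_(n + n)) f k : open U ->
  csmooth_on U f -> csmooth_on U (dzbar k f).
Proof.
move=> Uo sf.
have c d : csmooth_on U (fun=> d) by exact: csmooth_cst.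
exact: (csmoothM Uo (csmoothD Uo (csmooth_cpartial _ sf)
  (csmoothM Uo (c _) (csmooth_cpartial _ sf))) (c _)).
Qed.

Lemma partial_comp_smooth m m' (V : set 'rV[R]_m') (f : 'rV[R]_m' -> R)
    (T : 'rV[R]_m -> 'rV[R]_m') p k :
  open V -> smooth_on V f -> V (T p) ->
  (forall j, derivable (fun q => T q 0 j) p (delta_mx 0 k)) ->
  partial k (f \o T) p =
    \sum_j partial k (fun q => T q 0 j) p * partial j f (T p).
Proof.
by move=> Vo /smooth_onP/(_ 1%N) Cf VT dT; exact: (partial_comp Vo Cf VT dT).2.
Qed.

Definition coords_derivable n (T : 'rV[R]_(n + n) -> 'rV[R]_(n + n)) p : Prop :=
  forall a, cderivable (fun q => zcoord a (T q)) p.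

Lemma coords_derivableE n (T : 'rV[R]_(n + n) -> 'rV[R]_(n + n)) p j k :
  coords_derivable T p -> derivable (fun q => T q 0 j) p (delta_mx 0 k).
Proof.
move=> dT; rewrite -[j]fintype.splitK; case: (fintype.split j) => a /=.
  exact: (dT a k).1.
exact: (dT a k).2.
Qed.

Lemma cpartial_zcoord n (T : 'rV[R]_(n + n) -> 'rV[R]_(n + n)) p k a :
  cpartial k (fun q => zcoord a (T q)) p =
  partial k (fun q => T q 0 (lshift n a)) p +i* partial k (fun q => T q 0 (rshift n a)) p.
Proof. by []. Qed.

Lemma complex_sum I (r : seq I) (f g : I -> R) :
  (\sum_(i <- r) f i) +i* (\sum_(i <- r) g i) = \sum_(i <- r) (f i +i* g i).
Proof. by elim: r => [|i r IH]; rewrite ?big_nil// !big_cons -IH. Qed.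

(** The real chain rule has one term for each of the 2n real coordinates.  The two
    terms belonging to a complex coordinate combine into one, because w
    satisfies the Cauchy-Riemann equations at T p. *)
Lemma cpartial_comp n (V : set 'rV[R]_(n + n)) (w : 'rV[R]_(n + n) -> R[i])
    (T : 'rV[R]_(n + n) -> 'rV[R]_(n + n)) p k :
  open V -> csmooth_on V w -> V (T p) -> coords_derivable T p ->
  (forall l, dzbar l w (T p) = 0) ->
  cpartial k (w \o T) p =
    \sum_b cpartial k (fun q => zcoord b (T q)) p * dz b w (T p).
Proof.
move=> Vo [wr wi] VT dT hol.
rewrite /cpartial (partial_comp_smooth Vo wr VT); last first.
  by move=> j; exact: coords_derivableE.
rewrite (partial_comp_smooth Vo wi VT); last first.
  by move=> j; exact: coords_derivableE.
transitivity (\sum_(j : 'I_(n + n))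
    ((partial k (fun q => T q 0 j) p)%:C * cpartial j w (T p))).
  rewrite complex_sum; apply: eq_bigr => j _.
  by apply/eqP; rewrite eq_complex ReM ImM /= !mul0r subr0 addr0 !eqxx.
rewrite big_split_ord /= -big_split; apply: eq_bigr => b _ /=.
have [E1 E2] : cpartial (lshift n b) w (T p) = dz b w (T p) /\
    cpartial (rshift n b) w (T p) = 'i * dz b w (T p).
  exact: (hol_half (sqr_i R) (hol b)).
rewrite E1 E2 [X in _ + X]mulrA -[LHS]mulrDl; congr (_ * _).
by rewrite [RHS]complexE complexiE [X in _ = _ + X]mulrC.
Qed.

Lemma dz_comp n (V : set 'rV[R]_(n + n)) (w : 'rV[R]_(n + n) -> R[i])
    (T : 'rV[R]_(n + n) -> 'rV[R]_(n + n)) p k :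
  open V -> csmooth_on V w -> V (T p) -> coords_derivable T p ->
  (forall l, dzbar l w (T p) = 0) ->
  dz k (w \o T) p = \sum_b dz k (fun q => zcoord b (T q)) p * dz b w (T p).
Proof.
move=> Vo sw VT dT hol; rewrite {1}/dz !(cpartial_comp _ Vo sw VT dT hol).
rewrite mulr_sumr -sumrB mulr_suml; apply: eq_bigr => b _.
exact: half_diff_scale.
Qed.

(** In [hjacobian] the row index is the variable of differentiation, so the factors
    appear in the order in which the maps are applied. *)
Lemma hjacobian_comp n (V : set 'rV[R]_(n + n))
    (S T : 'rV[R]_(n + n) -> 'rV[R]_(n + n)) p :
  open V -> holomorphic_on V S -> V (T p) -> coords_derivable T p ->
  hjacobian (S \o T) p = hjacobian T p *m hjacobian S (T p).
Proof.
move=> Vo hS VT dT; apply/matrixP => k a; rewrite !mxE.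
rewrite (dz_comp k Vo (hS a).1 VT dT); last by move=> l; exact: (hS a).2.
by apply: eq_bigr => b _; rewrite !mxE.
Qed.

End Wirtinger.

(** * Iterated integrals of continuous functions of compact support *)

Section OneDimensionalIntegral.
Context {R : realType}.
Notation mu := (@lebesgue_measure R).
Implicit Types F G : R -> R.

Definition vanish_off (M : R) F := forall t, M < `|t| -> F t = 0.

Lemma measurable_ccitv (a b : R) : measurable (`[a, b]%classic : set (measurableTypeR R)).
Proof. exact: measurable_itv. Qed.

Lemma measure_ccitv (a b : R) : a <= b -> fine (mu `[a, b]%classic) = b - a.
Proof.
move=> ab; rewrite lebesgue_measure_itv /= lte_fin; have [//|ba] := ltP a b.
have -> : a = b by apply/eqP; rewrite eq_le ab.
by rewrite subrr.
Qed.

Lemma restrict_vanish M F : vanish_off M F -> F \_ `[- M, M] = F.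
Proof.
move=> F0; apply/funext => t; rewrite patchE; case: ifPn => // tM.
rewrite F0// ltNge ler_norml; apply: contra tM => tM.
by rewrite inE /= in_itv /=.
Qed.

Lemma continuous_integrable_itv F (a b : R) : continuous F ->
  mu.-integrable `[a, b] (EFin \o F).
Proof.
move=> Fc; apply: continuous_compact_integrable; first exact: segment_compact.
exact: continuous_subspaceT.
Qed.

Lemma integrable_vanish M F : continuous F -> vanish_off M F ->
  mu.-integrable [set: R] (EFin \o F).
Proof.
move=> Fc F0; have := (@integrable_mkcond _ _ R mu _ (EFin \o F) (measurable_ccitv (- M) M)).1
  (continuous_integrable_itv (- M) M Fc).
by rewrite restrict_EFin restrict_vanish.
Qed.

Lemma int_lin M F G a : continuous F -> continuous G ->
  vanish_off M F -> vanish_off M G ->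
  \int[mu]_(t in [set: R]) (a * F t + G t) =
  a * \int[mu]_(t in [set: R]) F t + \int[mu]_(t in [set: R]) G t.
Proof.
move=> Fc Gc F0 G0.
have aFc : continuous (fun t => a * F t).
  by move=> t; apply: continuousM; [exact: cst_continuous|exact: Fc].
have aF0 : vanish_off M (fun t => a * F t) by move=> t /F0 ->; rewrite mulr0.
rewrite (RintegralD measurableT (integrable_vanish aFc aF0) (integrable_vanish Gc G0)).
by rewrite (RintegralZl a measurableT (integrable_vanish Fc F0)).
Qed.

Lemma int_bound M c F : 0 <= M -> continuous F -> vanish_off M F ->
  (forall t, `|F t| <= c) ->
  `|\int[mu]_(t in [set: R]) F t| <= c * (2 * M).
Proof.
move=> M0 Fc F0 Fb.
rewrite -(restrict_vanish F0) -Rintegral_mkcond.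
have intF := continuous_integrable_itv (- M) M Fc.
apply: le_trans (le_normr_Rintegral (measurable_ccitv _ _) intF) _.
have nFc : continuous (fun t => `|F t|).
  by move=> t; apply: cvg_norm; exact: Fc.
apply: (@le_trans _ _ (\int[mu]_(t in `[- M, M]) c)).
  have cc : continuous (fun _ : R => c) by move=> t; exact: cst_continuous.
  exact: (le_Rintegral (measurable_ccitv _ _) (continuous_integrable_itv _ _ nFc)
    (continuous_integrable_itv _ _ cc) (fun t _ => Fb t)).
rewrite Rintegral_cst; last exact: measurable_ccitv.
rewrite measure_ccitv; last by rewrite (le_trans _ M0)// oppr_le0.
by rewrite opprK -mulr2n mulr_natl.
Qed.

Lemma int_gt0 M F t0 : continuous F -> vanish_off M F ->
  (forall t, 0 <= F t) -> 0 < F t0 ->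
  0 < \int[mu]_(t in [set: R]) F t.
Proof.
move=> Fc F0 Fge F1.
have : \forall t \near t0, F t0 / 2 < F t.
  by apply: (cvgr_gt _ (Fc t0)); rewrite ltr_pdivrMr// ltr_pMr// ltr1n.
move=> /nbhs_ballP[d /= d0 dP].
pose A : set (measurableTypeR R) := `[t0 - d / 2, t0 + d / 2]%classic.
have mA : measurable A by exact: measurable_ccitv.
have intF := continuous_integrable_itv (t0 - d / 2) (t0 + d / 2) Fc.
apply: (@lt_le_trans _ _ (\int[mu]_(t in A) F t)); last first.
  rewrite Rintegral_mkcond; apply: (le_Rintegral measurableT).
  - by rewrite -restrict_EFin; exact: (@integrable_mkcond _ _ R mu _ (EFin \o F) mA).1 intF.
  - exact: integrable_vanish F0.
  - by move=> t _; rewrite patchE; case: ifP.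
apply: (@lt_le_trans _ _ (\int[mu]_(t in A) (F t0 / 2))).
  have ab : t0 - d / 2 < t0 + d / 2 by rewrite ltrD2l gtrN ?divr_gt0.
  rewrite (Rintegral_cst _ mA) (measure_ccitv (ltW ab)).
  by rewrite mulr_gt0 ?divr_gt0// subr_gt0.
have cc : continuous (fun _ : R => F t0 / 2) by move=> t; exact: cst_continuous.
apply: (le_Rintegral mA (continuous_integrable_itv _ _ cc) intF) => t.
rewrite /A /= in_itv /= => /andP[t1 t2]; apply/ltW/dP.
rewrite /ball /= ltr_distlC; apply/andP; split; lra.
Qed.

End OneDimensionalIntegral.

Section IteratedIntegral.
Context {R : realType}.

(** The radius is a parameter, so that all slices of a function and all members of
    a finite family can share it. *)
Definition compactly_supported m (M : R) (f : 'rV[R]_m -> R) : Prop :=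
  continuous f /\ forall v, M < `|v| -> f v = 0.

Definition slice m (f : 'rV[R]_m.+1 -> R) (t : R) (v : 'rV[R]_m) : R :=
  f (row_mx (const_mx t : 'rV[R]_1) v).

Lemma norm_row_mx_ge m (t : R) (v : 'rV[R]_m) :
  `|t| <= `|row_mx (const_mx t : 'rV[R]_1) v| /\
  `|v| <= `|row_mx (const_mx t : 'rV[R]_1) v|.
Proof.
split.
  have := coord_le_norm (row_mx (const_mx t : 'rV[R]_1) v) (lshift m ord0).
  by rewrite row_mxEl mxE.
apply: norm_le_coord => // k.
have := coord_le_norm (row_mx (const_mx t : 'rV[R]_1) v) (rshift 1 k).
by rewrite row_mxEr.
Qed.

Lemma row_mx_continuous (T : topologicalType) m (h : T -> R) (g : T -> 'rV[R]_m) x :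
  {for x, continuous h} -> {for x, continuous g} ->
  {for x, continuous (fun y => row_mx (const_mx (h y) : 'rV[R]_1) (g y))}.
Proof.
move=> hc gc; apply: (@rV_continuous R T (1 + m)) => j.
rewrite -[j]fintype.splitK; case: (fintype.split j) => a /=.
  have -> : (fun q => (row_mx (const_mx (h q) : 'rV[R]_1) (g q)) 0 (lshift m a)) = h.
    by apply/funext => q; rewrite row_mxEl mxE.
  exact: hc.
have -> : (fun q => (row_mx (const_mx (h q) : 'rV[R]_1) (g q)) 0 (rshift 1 a)) =
    (fun q => g q 0 a).
  by apply/funext => q; rewrite row_mxEr.
apply: (@continuous_comp _ _ _ g (fun v : 'rV[R]_m => v 0 a)) => //.
exact: coord_continuous.
Qed.

Lemma slice_compact m M (f : 'rV[R]_m.+1 -> R) t :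
  compactly_supported M f -> compactly_supported M (slice f t).
Proof.
move=> [fc f0]; split => [v|v vM].
  apply: (@continuous_comp _ _ _
    (fun v : 'rV[R]_m => row_mx (const_mx t : 'rV[R]_1) v) f); last exact: fc.
  by apply: row_mx_continuous; [exact: cst_continuous|move=> ?].
by apply: f0; apply: lt_le_trans vM _; exact: (norm_row_mx_ge t v).2.
Qed.

(** Only the v in a compact ball matter, and continuity is uniform over a compact
    set of parameters. *)
Lemma slice_uniform m M (f : 'rV[R]_m.+1 -> R) t0 e : 0 < e ->
  compactly_supported M f ->
  \forall t \near t0, forall v, `|slice f t v - slice f t0 v| <= e.
Proof.
move=> e0 [fc f0].
pose K : set 'rV[R]_m := [set v | `|v| <= M].
have cK : compact K.
  apply: bounded_closed_compact.
    by exists M; split; [exact: num_real|move=> N MN v /= vM; rewrite (le_trans vM)// ltW].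
  rewrite (_ : K = (fun v => `|v|) @^-1` [set x | x <= M])//.
  by apply: closed_comp; [move=> v _; apply: norm_continuous|exact: closed_le].
have KP : \forall t \near t0, K `<=` (fun v => `|slice f t v - slice f t0 v| <= e).
  apply: ((compact_near_coveringP K).1 cK R (nbhs t0)
    (fun t v => `|slice f t v - slice f t0 v| <= e) (nbhs_filter t0)) => v _.
  have gc : {for (v, t0), continuous (fun z : 'rV[R]_m * R =>
      slice f z.2 z.1 - slice f t0 z.1)}.
    apply: continuousB.
      apply: (@continuous_comp _ _ _ (fun z : 'rV[R]_m * R =>
        row_mx (const_mx z.2 : 'rV[R]_1) z.1) f); last exact: fc.
      by apply: row_mx_continuous; [exact: cvg_snd|exact: cvg_fst].
    apply: (@continuous_comp _ _ _ (fun z : 'rV[R]_m * R =>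
      row_mx (const_mx t0 : 'rV[R]_1) z.1) f); last exact: fc.
    by apply: row_mx_continuous; [exact: cst_continuous|exact: cvg_fst].
  have := (cvgr0Pnorm_le _).1 _ e e0.
  move: gc; rewrite /prop_for /continuous_at /= subrr => gc H.
  exact: H gc.
apply: filterS KP => t Kt v.
have [vM|vM] := leP `|v| M; first exact: Kt.
by rewrite /slice !f0 ?subr0 ?normr0 ?ltW// (lt_le_trans vM)//; exact: (norm_row_mx_ge _ _).2.
Qed.

Definition iterated_linear m := forall M a (f g : 'rV[R]_m -> R),
  compactly_supported M f -> compactly_supported M g ->
  iterated_integral (fun v => a * f v + g v) =
  a * iterated_integral f + iterated_integral g.

Definition iterated_bounded m := forall M c (f : 'rV[R]_m -> R),
  0 <= M -> compactly_supported M f -> (forall v, `|f v| <= c) ->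
  `|iterated_integral f| <= c * (2 * M) ^+ m.

Lemma compactlyZD m M a (f g : 'rV[R]_m -> R) :
  compactly_supported M f -> compactly_supported M g ->
  compactly_supported M (fun v => a * f v + g v).
Proof.
move=> [fc f0] [gc g0]; split=> [v|v vM]; last by rewrite f0// g0// mulr0 addr0.
have ac : {for v, continuous (fun _ : 'rV[R]_m => a)} by exact: cst_continuous.
exact: (continuousD (continuousM ac (fc v)) (gc v)).
Qed.


(** Two slices with nearby parameters differ by a uniformly small function, whose
    integral is small by the bound in dimension m; linearity identifies it with
    the difference of the two inner integrals.  So continuity of the inner
    integral, which dimension m + 1 requires, rests on both properties in
    dimension m. *)
Lemma inner_regular m M (f : 'rV[R]_m.+1 -> R) :
  iterated_linear m -> iterated_bounded m -> 0 <= M ->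
  compactly_supported M f ->
  continuous (fun t => iterated_integral (slice f t)) /\
  vanish_off M (fun t => iterated_integral (slice f t)).
Proof.
move=> lin bnd M0 cf; split.
  move=> t0; apply/cvgrPdist_le => e e0.
  pose C := (2 * M) ^+ m + 1.
  have C0 : 0 < C by rewrite ltr_wpDl ?exprn_ge0 ?mulr_ge0.
  have := slice_uniform t0 (divr_gt0 e0 C0) cf.
  apply: filterS => t Ht; rewrite distrC.
  have cd := compactlyZD (-1) (slice_compact t0 cf) (slice_compact t cf).
  have E := lin _ (-1) _ _ (slice_compact t0 cf) (slice_compact t cf).
  rewrite mulN1r addrC in E; rewrite -E.
  apply: le_trans (bnd M (e / C) _ M0 cd _) _.
    by move=> v; rewrite mulN1r addrC; exact: Ht.
  by rewrite mulrAC ler_pdivrMr// ler_wpM2l ?(ltW e0)// lerDl.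
move=> t tM; apply/eqP; rewrite -normr_le0 -(mul0r ((2 * M) ^+ m)).
apply: (bnd M 0 _ M0 (slice_compact t cf)) => v.
rewrite /slice cf.2 ?normr0//.
exact: lt_le_trans tM (norm_row_mx_ge t v).1.
Qed.

Lemma iterated_linear_bounded m : iterated_linear m /\ iterated_bounded m.
Proof.
elim: m => [|m [lin bnd]].
  split=> [M a f g _ _|M c f _ _ H] //=.
  by rewrite expr0 mulr1.
have slices f : iterated_integral f =
    \int[lebesgue_measure]_(t in [set: R]) iterated_integral (slice f t) by [].
split=> [M a f g [fc f0] [gc g0]|M c f M0 cf H].
  pose N := Num.max M 0.
  have N0 : 0 <= N by rewrite le_max lexx orbT.
  have cf : compactly_supported N f.
    by split => // v Nv; apply: f0; rewrite (le_lt_trans _ Nv)// le_max lexx.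
  have cg : compactly_supported N g.
    by split => // v Nv; apply: g0; rewrite (le_lt_trans _ Nv)// le_max lexx.
  have [Fc F0] := inner_regular lin bnd N0 cf.
  have [Gc G0] := inner_regular lin bnd N0 cg.
  rewrite !slices -(int_lin a Fc Gc F0 G0).
  apply: eq_Rintegral => t _.
  exact: lin (slice_compact t cf) (slice_compact t cg).
have [Fc F0] := inner_regular lin bnd M0 cf.
rewrite slices exprSr mulrA; apply: (int_bound M0 Fc F0) => t.
by apply: bnd (slice_compact t cf) _ => // v; exact: H.
Qed.

Lemma iterated_lin m M a (f g : 'rV[R]_m -> R) :
  compactly_supported M f -> compactly_supported M g ->
  iterated_integral (fun v => a * f v + g v) =
  a * iterated_integral f + iterated_integral g.
Proof. exact: (iterated_linear_bounded m).1. Qed.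

Lemma iterated_ge0 m (f : 'rV[R]_m -> R) :
  (forall v, 0 <= f v) -> 0 <= iterated_integral f.
Proof.
elim: m f => [|m IH] f H /=; first exact: H.
by apply: Rintegral_ge0 => t _; exact: IH.
Qed.

(** The inner integral is a nonnegative continuous function of the outer variable,
    positive at the first coordinate of v by induction. *)
Lemma iterated_gt0 m M (f : 'rV[R]_m -> R) v : 0 <= M ->
  compactly_supported M f -> (forall v, 0 <= f v) -> 0 < f v ->
  0 < iterated_integral f.
Proof.
move=> M0; elim: m f v => [|m IH] f v cf H fv /=.
  by rewrite (_ : 0 = v)//; apply/rowP => -[].
have [lin bnd] := iterated_linear_bounded m.
have [Fc F0] := inner_regular lin bnd M0 cf.
apply: (int_gt0 (t0 := v 0 ord0) Fc F0).
  by move=> t; apply: iterated_ge0 => w; exact: H.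
apply: (IH _ (@rsubmx _ 1 1 m v) (slice_compact _ cf)).
  by move=> w; exact: H.
rewrite /slice (_ : @row_mx R 1 1 m _ _ = v)//; apply/rowP => j.
rewrite -[j](@fintype.splitK 1 m); case: (fintype.split _) => a /=.
  by rewrite row_mxEl mxE ord1; congr (v 0 _); apply/val_inj.
by rewrite row_mxEr mxE.
Qed.

Lemma iterated_le m M (f g : 'rV[R]_m -> R) :
  compactly_supported M f -> compactly_supported M g ->
  (forall v, f v <= g v) -> iterated_integral f <= iterated_integral g.
Proof.
move=> cf cg fg; rewrite -subr_ge0 -[X in _ <= X]addrC -mulN1r.
rewrite -(iterated_lin (-1) cf cg); apply: iterated_ge0 => v.
by rewrite mulN1r addrC subr_ge0.
Qed.

End IteratedIntegral.

(** * Positive definite Hermitian matrices *)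

Section PositiveDefinite.
Context {R : realType}.
Local Notation C := R[i].

Definition posdef n (A : 'M[C]_n) : Prop :=
  forall v : 'rV[C]_n, v != 0 -> 0 < (v *m A *m adjmx v) 0 0.

Lemma adjmxM a b c (A : 'M[C]_(a, b)) (B : 'M[C]_(b, c)) :
  adjmx (A *m B) = adjmx B *m adjmx A.
Proof. by rewrite /adjmx map_mxM trmx_mul. Qed.

Lemma adjmxK a b (A : 'M[C]_(a, b)) : adjmx (adjmx A) = A.
Proof. by apply/matrixP => i j; rewrite !mxE conjCK. Qed.

Lemma adjmxE a b (A : 'M[C]_(a, b)) i j : adjmx A i j = Num.conj (A j i).
Proof. by rewrite !mxE. Qed.

Lemma adjmxD a b (A B : 'M[C]_(a, b)) : adjmx (A + B) = adjmx A + adjmx B.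
Proof. by apply/matrixP => i j; rewrite !mxE rmorphD. Qed.

Lemma conj_realC (c : R) : Num.conj (c%:C : C) = c%:C.
Proof. by apply/eqP; rewrite eq_complex ReJ ImJ /= oppr0 !eqxx. Qed.

Lemma adjmxZ_real a b (c : R) (A : 'M[C]_(a, b)) : adjmx (c%:C *: A) = c%:C *: adjmx A.
Proof.
by apply/matrixP => i j; rewrite !mxE rmorphM /=; congr (_ * _); exact: conj_realC.
Qed.

Lemma adjmx_sum a b I (r : seq I) (A : I -> 'M[C]_(a, b)) :
  adjmx (\sum_(i <- r) A i) = \sum_(i <- r) adjmx (A i).
Proof.
elim: r => [|i r IH]; last by rewrite !big_cons adjmxD IH.
by rewrite !big_nil; apply/matrixP => i j; rewrite !mxE rmorph0.
Qed.

Lemma row_normE n (v : 'rV[C]_n) :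
  (v *m adjmx v) 0 0 = \sum_k `|v 0 k| ^+ 2.
Proof. by rewrite mxE; apply: eq_bigr => k _; rewrite adjmxE normCK. Qed.

Lemma row_norm_ge0 n (v : 'rV[C]_n) : 0 <= (v *m adjmx v) 0 0.
Proof. by rewrite row_normE sumr_ge0// => k _; rewrite exprn_ge0. Qed.

Lemma row_norm_gt0 n (v : 'rV[C]_n) : v != 0 -> 0 < (v *m adjmx v) 0 0.
Proof.
move=> v0; rewrite lt_def row_norm_ge0 andbT; apply: contra v0.
rewrite row_normE psumr_eq0; last by move=> k _; rewrite exprn_ge0.
move=> /allP v0; apply/eqP/rowP => k; rewrite mxE.
have := v0 k; rewrite mem_index_enum => /(_ isT).
by rewrite sqrf_eq0 normr_eq0 => /eqP.
Qed.

Lemma posdef_unit n (A : 'M[C]_n) : posdef A -> A \in unitmx.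
Proof.
move=> pA; rewrite -row_free_unit -kermx_eq0.
apply/rowV0P => v /sub_kermxP vA; apply/eqP/negP => /negP /pA.
by rewrite vA mul0mx mxE ltxx.
Qed.

(** By the spectral theorem the determinant is the product of the eigenvalues, and
    each eigenvalue is the value of the form on a row of a unitary matrix that
    diagonalises A. *)
Lemma posdef_det_gt0 n (A : 'M[C]_n) : adjmx A = A -> posdef A -> 0 < \det A.
Proof.
move=> hA pA.
have nA : A \is normalmx.
  apply/normalmxP.
  by rewrite (_ : map_mx _ A^T = A)// -[RHS]hA /adjmx map_trmx.
have Aeq := orthomx_spectralP nA.
set P := spectralmx A in Aeq; set d := spectral_diag A in Aeq.
have uP : P \in unitmx by exact: spectral_unit.
have iP : invmx P = adjmx P.
  by rewrite invmx_unitary ?spectral_unitarymx// /adjmx map_trmx.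
have -> : \det A = \prod_i d 0 i.
  rewrite Aeq !det_mulmx mulrAC -det_mulmx mulVmx// det1 mul1r.
  by rewrite det_diag.
apply: prodr_gt0 => i _.
have -> : d 0 i = (row i P *m A *m adjmx (row i P)) 0 0.
  have E : P *m A *m adjmx P = diag_mx d.
    by rewrite Aeq -iP !mulmxA mulmxV// mul1mx mulmxK.
  transitivity ((P *m A *m adjmx P) i i); first by rewrite E mxE eqxx mulr1n.
  rewrite -row_mul [LHS]mxE [RHS]mxE; apply: eq_bigr => k _.
  by rewrite !mxE.
apply: pA; apply/eqP => Pi0.
have : row i P *m invmx P = 0 by rewrite Pi0 mul0mx.
rewrite -row_mul mulmxV// => /rowP/(_ i); rewrite !mxE eqxx => /eqP.
by rewrite oner_eq0.
Qed.

Lemma Re_gt0 (z : C) : 0 < z -> 0 < complex.Re z /\ z = (complex.Re z)%:C.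
Proof.
case: z => a b; rewrite ltcE /= => /andP[/eqP b0 a0]; split => //.
by rewrite b0.
Qed.

(** The diagonal entries of the inverse are the values of the form on the rows of
    the inverse. *)
Lemma posdef_trace_inv n (A : 'M[C]_n) : (0 < n)%N -> adjmx A = A -> posdef A ->
  0 < \tr (invmx A).
Proof.
move=> n0 hA pA; have uA := posdef_unit pA.
have hiA : adjmx (invmx A) = invmx A.
  have : adjmx (invmx A) *m A = 1%:M.
    rewrite -[X in _ *m X]hA -adjmxM mulmxV//.
    by apply/matrixP => i j; rewrite !mxE rmorph_nat eq_sym.
  by move=> /(congr1 (mulmx^~ (invmx A))); rewrite mulmxK// mul1mx.
have diag i : 0 < invmx A i i.
  have -> : invmx A i i = (row i (invmx A) *m A *m adjmx (row i (invmx A))) 0 0.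
    rewrite -row_mul mulVmx// row1 -[LHS](conjCK _) -adjmxE hiA.
    rewrite mxE (bigD1 i)//= big1 ?addr0.
      by rewrite !mxE !eqxx mul1r -[in RHS]hiA adjmxE conjCK -[LHS]adjmxE hiA.
    by move=> k ki; rewrite !mxE eqxx (negbTE ki) mul0r.
  apply: pA; apply/eqP => i0.
  have : row i (invmx A) *m A = 0 by rewrite i0 mul0mx.
  rewrite -row_mul mulVmx// => /rowP/(_ i); rewrite !mxE eqxx => /eqP.
  by rewrite oner_eq0.
rewrite /mxtrace (bigD1 (Ordinal n0))//= ltr_wpDr//.
by apply: sumr_ge0 => i _; exact: ltW.
Qed.

(** Invariance of a trace under a change of chart with Jacobian J: the metric B
    becomes J B J^*, and the Euclidean form, with identity matrix, becomes
    J J^*. *)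
Lemma trace_invmx_congruence n (J B : 'M[C]_n) :
  J \in unitmx -> B \in unitmx ->
  \tr (invmx (J *m B *m adjmx J) *m (J *m adjmx J)) = \tr (invmx B).
Proof.
move=> uJ uB.
have uJ' : adjmx J \in unitmx.
  have : adjmx J *m adjmx (invmx J) = 1%:M.
    rewrite -adjmxM mulVmx//.
    by apply/matrixP => i j; rewrite !mxE rmorph_nat eq_sym.
  by move=> /mulmx1_unit[].
have E : J *m B *m adjmx J *m (invmx (adjmx J) *m invmx B *m invmx J) = 1%:M.
  by rewrite -!mulmxA (mulKVmx uJ') (mulKVmx uB) mulmxV.
have uM : J *m B *m adjmx J \in unitmx by have [] := mulmx1_unit E.
have -> : invmx (J *m B *m adjmx J) = invmx (adjmx J) *m invmx B *m invmx J.
  by rewrite -[RHS](mulKmx uM) E mulmx1.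
rewrite -!mulmxA (mulKmx uJ) mxtrace_mulC -mulmxA (mulmxV uJ') mulmx1.
by [].
Qed.

End PositiveDefinite.

(** * Charts *)

Section ManifoldTopology.
Context {R : realType} {n : nat} (X : complexManifold R n).
Implicit Types (i j : index X) (p : 'rV[R]_(n + n)).

Lemma codom_chart i (x : X) : dom i x -> codom_of i (chart i x).
Proof. by move=> ix; exists x. Qed.

Lemma chartVK i p : codom_of i p -> chart i (chartV i p) = p.
Proof. by move=> [x ix <-]; rewrite chartK. Qed.

Lemma dom_chartV i p : codom_of i p -> dom i (chartV i p).
Proof. by move=> [x ix <-]; rewrite chartK. Qed.

Lemma overlapE i j p :
  (@chart R n X i @` (dom i `&` dom j)) p <-> codom_of i p /\ dom j (chartV i p).
Proof.
split=> [[x [ix jx] <-]|[ip jp]].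
  by rewrite chartK//; split => //; exact: codom_chart.
exists (chartV i p); last exact: chartVK.
by split => //; exact: dom_chartV.
Qed.

(** With W the domain of another chart j, this is the set on which the transition
    map from chart i to chart j is meaningful. *)
Definition pull i (W : set X) : set 'rV[R]_(n + n) :=
  codom_of i `&` (chartV i @^-1` W).

Lemma open_pull i (W : set X) : open W -> open (pull i W).
Proof.
move=> Wo; rewrite openE => p [ip Wp]; apply: filterI.
  by apply: open_nbhs_nbhs; split => //; exact: codom_open.
apply: (chartV_continuous ip); exact: open_nbhs_nbhs.
Qed.

Lemma overlap_pull i j : @chart R n X i @` (dom i `&` dom j) = pull i (dom j).
Proof. by apply/seteqP; split => p /overlapE. Qed.

Lemma chartV_transition i j p : pull i (dom j) p ->
  chartV j (transition i j p) = chartV i p.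
Proof. by move=> [ip jp]; rewrite /transition /= chartK. Qed.

Lemma transition_smooth i j k :
  smooth_on (pull i (dom j)) (fun p => transition i j p 0 k).
Proof.
have := @transition_holomorphic R n X i j; rewrite overlap_pull => H.
rewrite -[k]fintype.splitK; case: (fintype.split k) => a /=.
  exact: (H a).1.1.
exact: (H a).1.2.
Qed.

Lemma transition_zcoord i j a :
  csmooth_on (pull i (dom j)) (fun p => zcoord a (transition i j p)).
Proof.
have := @transition_holomorphic R n X i j; rewrite overlap_pull => H.
exact: (H a).1.
Qed.

Lemma transition_dzbar i j a l p : pull i (dom j) p ->
  dzbar l (fun q => zcoord a (transition i j q)) p = 0.
Proof.
have := @transition_holomorphic R n X i j; rewrite overlap_pull => H.
exact: (H a).2.
Qed.

Lemma smooth_fun_continuous (f : X -> R) : smooth_fun f -> continuous f.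
Proof.
move=> sf x; have [i ix] := dom_cover x.
have fc := smooth_continuous (sf i) (codom_chart ix).
have gc : {for x, continuous ((f \o chartV i) \o chart i)}.
  by apply: continuous_comp; [exact: chart_continuous|exact: fc].
apply: (continuous_eq_open (dom_open i) ix _ gc) => y iy /=.
by rewrite chartK.
Qed.

End ManifoldTopology.

(** * Bump functions on a manifold *)

Section SquareDistance.
Context {R : realType} {m : nat}.
Implicit Types p q : 'rV[R]_m.

(** The square of the Euclidean distance is smooth, unlike the sup norm which gives
    row vectors their topology. *)
Definition sqdist p q : R := \sum_j (q 0 j - p 0 j) ^+ 2.

Lemma sqdist0 p : sqdist p p = 0.
Proof. by rewrite /sqdist big1// => j _; rewrite subrr expr0n. Qed.

Lemma coord_sqdist p q j : (q 0 j - p 0 j) ^+ 2 <= sqdist p q.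
Proof. by rewrite /sqdist (bigD1 j)//= lerDl sumr_ge0// => k _; exact: sqr_ge0. Qed.

Lemma sqdist_ball p q r e : 0 <= r -> r < e -> sqdist p q <= r ^+ 2 -> ball p e q.
Proof.
move=> r0 re H; rewrite -ball_normE /ball_ /=; apply: le_lt_trans re.
apply: norm_le_coord => // j; rewrite !mxE distrC.
rewrite -(@ler_pXn2r _ 2)// ?nnegrE//.
by rewrite real_normK ?num_real//; apply: le_trans H; exact: coord_sqdist.
Qed.

Lemma sqdist_smooth m' (U : set 'rV[R]_m') (T : 'rV[R]_m' -> 'rV[R]_m) p : open U ->
  (forall j, smooth_on U (fun q : 'rV[R]_m' => T q 0 j)) ->
  smooth_on U (fun q : 'rV[R]_m' => sqdist p (T q)).
Proof.
move=> Uo sT; apply: smooth_sum => // j _.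
have sd := smoothB Uo (sT j) (smooth_cst (p 0 j)).
by apply: (smooth_eq Uo _ (smoothM Uo sd sd)) => q _; rewrite expr2.
Qed.

Lemma sqdist_continuous p : continuous (sqdist p).
Proof.
move=> q; apply: (@smooth_continuous _ _ setT) => //.
apply: (sqdist_smooth (T := id)); first exact: openT.
by move=> j; apply: smooth_coord; exact: openT.
Qed.

Lemma sqdist_compact p r : 0 <= r -> compact [set q | sqdist p q <= r ^+ 2].
Proof.
move=> r0; apply: bounded_closed_compact.
  exists (`|p| + (r + 1)); split; first exact: num_real.
  move=> N MN q /= qr; apply: le_trans (ltW MN).
  rewrite -(subrK p q) addrC; apply: le_trans (ler_normD _ _) _.
  rewrite lerD2l; apply: ltW.
  have : ball p (r + 1) q by apply: sqdist_ball qr => //; rewrite ltrDl.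
  by rewrite -ball_normE /ball_ /= distrC.
apply: (@closed_comp _ _ (sqdist p) [set x | x <= r ^+ 2]); last exact: closed_le.
by move=> q _; exact: sqdist_continuous.
Qed.

End SquareDistance.

Section Bump.
Context {R : realType} {n : nat} (X : complexManifold R n).
Hypothesis X_hausdorff : hausdorff_space X.
Variables (i0 : index X) (x0 : X) (r : R).
Hypothesis i0x0 : dom i0 x0.
Hypothesis r0 : 0 < r.
Hypothesis ball_codom :
  forall q, sqdist (chart i0 x0) q <= r ^+ 2 -> codom_of i0 q.

Definition chart_bump (x : X) : R :=
  if pselect (dom i0 x) then bump_profile (r ^+ 2 - sqdist (chart i0 x0) (chart i0 x))
  else 0.

Definition bump_core : set X :=
  chartV i0 @` [set q | sqdist (chart i0 x0) q <= r ^+ 2].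

Lemma bump_core_dom : bump_core `<=` dom i0.
Proof. by move=> x [q /= qr <-]; apply: dom_chartV; exact: ball_codom. Qed.

(** The core is compact, hence closed in a Hausdorff space; therefore the extension
    of the bump by zero is smooth across the boundary of the chart. *)
Lemma bump_core_closed : closed bump_core.
Proof.
apply: (compact_closed X_hausdorff); apply: continuous_compact; last first.
  by apply: sqdist_compact; exact: ltW.
apply: continuous_in_subspaceT => q; rewrite inE /= => qr.
by apply: chartV_continuous; exact: ball_codom.
Qed.

Lemma bump_dom x : dom i0 x ->
  chart_bump x = bump_profile (r ^+ 2 - sqdist (chart i0 x0) (chart i0 x)).
Proof. by rewrite /chart_bump; case: pselect. Qed.

Lemma bump_out x : ~ bump_core x -> chart_bump x = 0.
Proof.
move=> Kx; rewrite /chart_bump; case: pselect => // ix.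
rewrite /bump_profile flat_neg// subr_le0 leNgt; apply/negP => H; apply: Kx.
by exists (chart i0 x); [exact: ltW|exact: chartK].
Qed.

Lemma bump_ge0 x : 0 <= chart_bump x.
Proof. by rewrite /chart_bump; case: pselect => //= ?; exact: profile_ge0. Qed.

Lemma bump_gt0 : 0 < chart_bump x0.
Proof. by rewrite bump_dom// sqdist0 subr0 profile_gt0 exprn_gt0. Qed.

Lemma bump_pull i q : pull i (dom i0) q ->
  chart_bump (chartV i q) =
  bump_profile (r ^+ 2 - sqdist (chart i0 x0) (transition i i0 q)).
Proof. by move=> [iq i0q]; rewrite bump_dom. Qed.

Lemma bump_support : closure [set x | chart_bump x != 0] `<=` dom i0.
Proof.
apply: (@subset_trans _ bump_core); last exact: bump_core_dom.
rewrite [X in _ `<=` X](closure_id _).1; last exact: bump_core_closed.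
apply: closureS => x /= /eqP bx; apply: contrapT => Kx; apply: bx.
exact: bump_out.
Qed.

Lemma bump_smooth : smooth_fun chart_bump.
Proof.
move=> i; apply: smooth_local => p ip.
have [i0p|i0p] := pselect (dom i0 (chartV i p)).
  exists (pull i (dom i0)), (fun q =>
    bump_profile (r ^+ 2 - sqdist (chart i0 x0) (transition i i0 q))).
  have Uo : open (pull i (dom i0)) by apply: open_pull; exact: dom_open.
  split => //; first by move=> q /bump_pull.
  apply: smooth_profile => //; apply: (smoothB Uo (smooth_cst _)).
  by apply: (sqdist_smooth _ Uo) => j; exact: transition_smooth.
have Ko : open (~` bump_core) by apply: closed_openC; exact: bump_core_closed.
exists (pull i (~` bump_core)), (fun=> 0).
split; [exact: open_pull| |by move=> q [_ /= /bump_out]|exact: smooth_cst].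
by split => //= /bump_core_dom.
Qed.

End Bump.

(** * Partitions of unity *)

Section Partition.
Context {R : realType} {n : nat} (X : complexManifold R n).
Hypothesis X_compact : compact [set: X].

Lemma chart_ball (i : index X) (x : X) : dom i x ->
  exists2 r, 0 < r &
    forall q, sqdist (chart i x) q <= r ^+ 2 -> codom_of i q.
Proof.
move=> ix; have := @codom_open R n X i; rewrite openE => /(_ _ (codom_chart ix)).
move=> /nbhs_ballP[d /= d0 dP]; exists (d / 2); first by rewrite divr_gt0.
move=> q H; apply: dP; apply: sqdist_ball H; first by rewrite divr_ge0// ltW.
by rewrite ltr_pdivrMr// ltr_pMr// ltr1n.
Qed.

Definition local_bump (x : X) (ib : index X * (X -> R)) : Prop :=
  [/\ smooth_fun ib.2, forall y, 0 <= ib.2 y, 0 < ib.2 x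
    & closure [set y | ib.2 y != 0] `<=` dom ib.1].

Lemma local_bump_exists (x : X) : exists ib, local_bump x ib.
Proof.
have hX := @manifold_hausdorff R n X.
have [i ix] := dom_cover x; have [r r0 Hr] := chart_ball ix.
exists (i, chart_bump i x r); split.
- exact: bump_smooth.
- by move=> y; exact: bump_ge0.
- exact: bump_gt0.
- exact: bump_support.
Qed.

(** Every point is the centre of a bump supported in a chart.  By compactness
    finitely many of these bumps have a positive sum, and they are divided by
    it. *)
Lemma partition_exists : exists s : seq (index X * (X -> R)), partition_of_unity s.
Proof.
pose ib x := projT1 (cid (local_bump_exists x)).
have ibP x : local_bump x (ib x) := projT2 (cid (local_bump_exists x)).
(* Finite sequences directed by inclusion: compactness then yields one sequence
   whose bumps cover X. *)
pose F : set_system (seq X) :=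
  filter_from [set: seq X] (fun s0 => [set s : seq X | {subset s0 <= s}]).
have FF : Filter F.
  apply: filter_from_filter; first by exists [::].
  move=> s1 s2 _ _; exists (s1 ++ s2) => // s H.
  by split=> y ys; apply: H; rewrite mem_cat ys ?orbT.
have [s _ /(_ s (fun y ys => ys)) scov] : \forall s \near F,
    [set: X] `<=` (fun x : X => has (fun y => 0 < (ib y).2 x) s).
  apply: ((compact_near_coveringP [set: X]).1 X_compact (seq X) F
    (fun (s : seq X) (x : X) => has (fun y => 0 < (ib y).2 x) s) FF) => x _.
  have [sb _ bx _] := ibP x.
  exists ([set y | 0 < (ib x).2 y], [set s : seq X | x \in s]); last first.
    by move=> [y s] [/= yx xs]; apply/hasP; exists x.
  split=> /=.
    exact: (cvgr_gt _ (@smooth_fun_continuous _ _ _ _ sb x) 0 bx).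
  by exists [:: x] => // s; apply; rewrite mem_head.
pose B y := \sum_(x <- s) (ib x).2 y.
have B0 y : 0 < B y.
  have /hasP[x xs xy] := scov y I.
  rewrite /B (big_rem x)//= ltr_wpDr//; apply: sumr_ge0 => z _.
  by have [_ ] := ibP z.
have sB i : smooth_on (codom_of i) (B \o chartV i).
  by apply: smooth_sum => [|x _]; [exact: codom_open|have [] := ibP x].
exists [seq ((ib x).1, fun y => (ib x).2 y / B y) | x <- s]; split.
  move=> k; rewrite size_map => ks d.
  case: s ks {scov} @B B0 sB => [//|x1 s1] ks B B0 sB.
  rewrite (nth_map x1); last exact: ks.
  set x := nth _ _ _.
  have [sb b0 _ clb] := ibP x; split.
  - move=> i; have Uo := @codom_open R n X i.
    apply: (smoothM Uo (sb i)); apply: (smoothV Uo _ (sB i)).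
    by move=> p _; rewrite /= gt_eqF.
  - by move=> y; rewrite divr_ge0// ltW.
  - apply: subset_trans clb; apply: closureS => y /=; apply: contraNN => /eqP ->.
    by rewrite mul0r.
move=> y; rewrite big_map -mulr_suml divff//.
by rewrite gt_eqF//; exact: B0.
Qed.

End Partition.

(** * Jacobians of the transition maps *)

Section TransitionJacobian.
Context {R : realType} {n : nat} (X : complexManifold R n).
Implicit Types (i j k : index X) (p : 'rV[R]_(n + n)).

Lemma hjacobian_eq (U : set 'rV[R]_(n + n)) F G p : open U -> U p ->
  (forall q, U q -> F q = G q) -> hjacobian F p = hjacobian G p.
Proof.
move=> Uo Up FG; apply/matrixP => k a; rewrite !mxE.
by apply: (dz_eq k Uo Up) => q Uq; rewrite FG.
Qed.

Lemma hjacobian_id p : hjacobian id p = 1%:M.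
Proof.
have i2 : 'i * 'i = -1 :> R[i] by rewrite -expr2 sqr_i.
apply/matrixP => k a; rewrite !mxE /dz !cpartial_zcoord !partial_coord.
rewrite !(inj_eq (@lshift_inj _ _)) !(inj_eq (@rshift_inj _ _)).
rewrite eq_lrshift eq_rlshift [a == k]eq_sym.
case: (k == a); last first.
  have -> : (0 +i* 0 : R[i]) = 0 by [].
  by rewrite mulr0 subr0 mul0r.
have -> : (1 +i* 0 : R[i]) = 1 by [].
have -> : (0 +i* 1 : R[i]) = 'i by exact: complexiE.
by rewrite i2 opprK -mulr2n divff// pnatr_eq0.
Qed.

Lemma transition_derivable i j p : pull i (dom j) p ->
  coords_derivable (transition i j) p.
Proof. by move=> ip a; apply: csmooth_cderivable ip; exact: transition_zcoord. Qed.

(** Near p the transition from chart i to chart k factors through chart j. *)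
Lemma jacobian_cocycle i j k p :
  codom_of i p -> dom j (chartV i p) -> dom k (chartV i p) ->
  hjacobian (transition i k) p =
  hjacobian (transition i j) p *m hjacobian (transition j k) (transition i j p).
Proof.
move=> ip jp kp.
have Uo : open (pull i (dom j `&` dom k)).
  by apply: open_pull; apply: openI; exact: dom_open.
have Vo : open (pull j (dom k)) by apply: open_pull; exact: dom_open.
have Up : pull i (dom j `&` dom k) p by split.
have -> : hjacobian (transition i k) p =
    hjacobian (transition j k \o transition i j) p.
  apply: (hjacobian_eq Uo Up) => q [iq [jq kq]].
  by rewrite /transition /= chartK.
apply: (hjacobian_comp Vo).
- by have := @transition_holomorphic R n X j k; rewrite overlap_pull.
- by split; [exact: codom_chart|rewrite /= chartV_transition].
- by apply: transition_derivable; split.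
Qed.

Lemma jacobian_self i p : codom_of i p -> hjacobian (transition i i) p = 1%:M.
Proof.
move=> ip; rewrite -(hjacobian_id p).
by apply: (hjacobian_eq (@codom_open R n X i) ip) => q iq; exact: chartVK.
Qed.

(** The Jacobian of the transition back to chart i is an inverse. *)
Lemma jacobian_unit i j p : codom_of i p -> dom j (chartV i p) ->
  hjacobian (transition i j) p \in unitmx.
Proof.
move=> ip jp; have := jacobian_cocycle ip jp (dom_chartV ip).
rewrite (jacobian_self ip) => /esym E; exact: (mulmx1_unit E).1.
Qed.

Lemma jacobian_smooth i j a b :
  csmooth_on (pull i (dom j)) (fun p => hjacobian (transition i j) p a b).
Proof.
have Uo : open (pull i (dom j)) by apply: open_pull; exact: dom_open.
apply: (csmooth_eq Uo _ (csmooth_dz a Uo (transition_zcoord i j b))) => p _.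
by rewrite mxE.
Qed.

End TransitionJacobian.

(** * Existence of Hermitian metrics *)

Section HermitianExistence.
Context {R : realType} {n : nat} (X : complexManifold R n).

Definition smooth_partition (N : nat) (c : 'I_N -> index X)
    (rho : 'I_N -> X -> R) : Prop :=
  [/\ forall k, smooth_fun (rho k), forall k x, 0 <= rho k x,
      forall k, closure [set x | rho k x != 0] `<=` dom (c k)
    & forall x, \sum_k rho k x = 1].

Lemma partition_indexed (s : seq (index X * (X -> R))) :
  partition_of_unity s ->
  smooth_partition (fun k => (tnth (in_tuple s) k).1)
                    (fun k => (tnth (in_tuple s) k).2).
Proof.
move=> [sP s1].
have aP (k : 'I_(size s)) := sP k (ltn_ord k) (tnth (in_tuple s) k).
have E (k : 'I_(size s)) :
  nth (tnth (in_tuple s) k) s k = tnth (in_tuple s) k := esym (tnth_nth _ (in_tuple s) k).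
split.
- by move=> k; have := aP k; rewrite /= E => -[].
- by move=> k; have := aP k; rewrite /= E => -[].
- by move=> k; have := aP k; rewrite /= E => -[].
- by move=> x; rewrite -(s1 x) [RHS]big_tnth.
Qed.

Lemma csmooth_local m (U : set 'rV[R]_m) (f : 'rV[R]_m -> R[i]) :
  (forall p, U p -> exists V, V p /\ csmooth_on V f) -> csmooth_on U f.
Proof.
by move=> H; split=> s p /H [V [Vp [fr fi]]]; [exact: fr|exact: fi].
Qed.

(** In a sum weighted by a partition of unity, a Jacobian may be evaluated outside
    the domain of its transition map; the weight vanishes there. *)
Lemma realscale_eq a b (r : R) (A B : 'M[R[i]]_(a, b)) :
  (r != 0 -> A = B) -> r%:C *: A = r%:C *: B.
Proof.
have [->|r0] := eqVneq r 0; last by move=> /(_ isT) ->.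
by rewrite rmorph0 !scale0r.
Qed.

Variables (N : nat) (c : 'I_N -> index X) (rho : 'I_N -> X -> R).
Hypothesis part : smooth_partition c rho.

Lemma partition_dom k x : rho k x != 0 -> dom (c k) x.
Proof. by case: part => _ _ H _ ?; apply: H; exact: subset_closure. Qed.

Lemma partition_pos x : exists k, 0 < rho k x.
Proof.
case: part => _ r0 _ r1; apply/not_existsP => H.
have := r1 x; rewrite big1.
  by move/eqP; rewrite eq_sym oner_eq0.
by move=> k _; apply/eqP; rewrite eq_le r0 andbT leNgt; apply/negP; exact: H.
Qed.

(** The average, with the weights rho, of the flat metrics of the charts c k: the
    pullback to chart i of the identity matrix in chart c k is J J^*, with J the
    Jacobian of the transition. *)
Definition glued_metric : local_forms X := fun i p =>
  \sum_k (rho k (chartV i p))%:C *: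
    (hjacobian (transition i (c k)) p *m adjmx (hjacobian (transition i (c k)) p)).

Lemma glued_smooth i a b : csmooth_on (codom_of i) (fun p => glued_metric i p a b).
Proof.
have Uo := @codom_open R n X i.
pose f k p := ((rho k (chartV i p))%:C *:
  (hjacobian (transition i (c k)) p *m adjmx (hjacobian (transition i (c k)) p))) a b.
have -> : (fun p => glued_metric i p a b) = (fun p => \sum_k f k p).
  by apply/funext => p; rewrite summxE.
apply: (csmooth_sum Uo) => k _; apply: csmooth_local => p ip.
have [sr _ cl _] := part.
have [kp|kp] := pselect (dom (c k) (chartV i p)).
  exists (pull i (dom (c k))); split; first by split.
  have Vo : open (pull i (dom (c k))) by apply: open_pull; exact: dom_open.
  have sJ := @jacobian_smooth R n X i (c k).
  have sJ' : forall u v, csmooth_on (pull i (dom (c k)))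
      (fun p => adjmx (hjacobian (transition i (c k)) p) u v).
    move=> u v; apply: (csmooth_eq Vo _ (csmooth_conj Vo (sJ v u))) => q _.
    by rewrite adjmxE.
  have srho : smooth_on (pull i (dom (c k))) (rho k \o chartV i).
    by apply: smooth_sub (sr k i) => q [].
  apply: (csmooth_eq Vo _ (csmoothM Vo (csmooth_real srho) (csmooth_mulmx Vo sJ sJ' a b))).
  by move=> q _; rewrite /f [RHS]mxE.
exists (pull i (~` closure [set x | rho k x != 0])); split.
  by split => //= /cl.
have Vo : open (pull i (~` closure [set x | rho k x != 0])).
  by apply: open_pull; apply: closed_openC; exact: closed_closure.
apply: (csmooth_eq Vo _ (csmooth_cst _ 0)) => q [iq /= nq].
rewrite /f (_ : rho k (chartV i q) = 0) ?scale0r ?mxE//.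
by apply: contrapT => /eqP r0; apply: nq; exact: subset_closure.
Qed.

Lemma glued_metric_hermitian : hermitian_metric glued_metric.
Proof.
have [_ r0 _ _] := part.
split.
- exact: glued_smooth.
- move=> i p ip; rewrite /glued_metric adjmx_sum; apply: eq_bigr => k _.
  by rewrite adjmxZ_real adjmxM adjmxK.
- move=> i p ip v v0.
  have E k : (v *m ((rho k (chartV i p))%:C *:
      (hjacobian (transition i (c k)) p *m adjmx (hjacobian (transition i (c k)) p)))
      *m adjmx v) 0 0 = (rho k (chartV i p))%:C *
      ((v *m hjacobian (transition i (c k)) p) *m
       adjmx (v *m hjacobian (transition i (c k)) p)) 0 0.
    by rewrite -scalemxAr -scalemxAl mxE adjmxM !mulmxA.
  rewrite /glued_metric mulmx_sumr mulmx_suml summxE.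
  have [k kp] := partition_pos (chartV i p).
  rewrite (bigD1 k)//= ltr_wpDr//.
    apply: sumr_ge0 => l _; rewrite E mulr_ge0 ?row_norm_ge0//.
    by rewrite ler0c.
  rewrite E mulr_gt0//; first by rewrite ltcR.
  apply: row_norm_gt0; apply: contra v0 => /eqP vJ.
  have uJ : hjacobian (transition i (c k)) p \in unitmx.
    by apply: jacobian_unit => //; apply: partition_dom; rewrite gt_eqF.
  by rewrite -(mulmxK uJ v) vJ mul0mx.
- move=> i j p /overlapE[ip jp].
  have Tp : chartV j (transition i j p) = chartV i p.
    by apply: chartV_transition; split.
  rewrite /glued_metric mulmx_sumr mulmx_suml; apply: eq_bigr => k _.
  rewrite Tp -scalemxAr -scalemxAl.
  apply: realscale_eq => r.
  rewrite (jacobian_cocycle ip jp (partition_dom r)).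
  by rewrite adjmxM !mulmxA.
Qed.

End HermitianExistence.

Lemma hermitian_metric_exists (R : realType) (n : nat) (X : complexManifold R n) :
  compact [set: X] -> exists g : local_forms X, hermitian_metric g.
Proof.
move=> /partition_exists [s /partition_indexed part].
by eexists; exact: glued_metric_hermitian part.
Qed.

(** * Curvature of a conformally rescaled metric *)

Section Conformal.
Context {R : realType} {n : nat} (X : complexManifold R n).
Variable g : local_forms X.
Hypothesis gH : hermitian_metric g.
Implicit Types (i : index X) (p : 'rV[R]_(n + n)) (f : X -> R).

Lemma metric_posdef i p : codom_of i p -> posdef (g i p).
Proof. by case: gH => _ _ H _; exact: H. Qed.

Lemma metric_selfadj i p : codom_of i p -> adjmx (g i p) = g i p.
Proof. by case: gH => _ H _ _; exact: H. Qed.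

Lemma metric_csmooth i k l : csmooth_on (codom_of i) (fun p => g i p k l).
Proof. by case: gH => H _ _ _; exact: H. Qed.

Lemma metric_transition i j p : pull i (dom j) p ->
  g i p = hjacobian (transition i j) p *m g j (transition i j p)
            *m adjmx (hjacobian (transition i j) p).
Proof. by case: gH => _ _ _ H ip; apply: H; rewrite overlap_pull. Qed.

Lemma metric_unit i p : codom_of i p -> g i p \in unitmx.
Proof. by move=> ip; apply: posdef_unit; exact: metric_posdef. Qed.

Definition metric_det i p : R := complex.Re (\det (g i p)).

Lemma metric_detE i p : codom_of i p ->
  0 < metric_det i p /\ \det (g i p) = (metric_det i p)%:C.
Proof.
move=> ip; apply: Re_gt0.
exact: posdef_det_gt0 (metric_selfadj ip) (metric_posdef ip).
Qed.

Lemma metric_det_smooth i : smooth_on (codom_of i) (metric_det i).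
Proof. exact: (csmooth_det (@codom_open R n X i) (metric_csmooth i)).1. Qed.

Lemma conformal_hermitian f : smooth_fun f -> hermitian_metric (conformal f g).
Proof.
move=> sf; split.
- move=> i k l; have Uo := @codom_open R n X i.
  apply: (csmooth_eq Uo _ (csmoothM Uo (csmooth_real (smooth_exp Uo (sf i)))
    (metric_csmooth i k l))) => p _.
  by rewrite /conformal [RHS]mxE.
- by move=> i p ip; rewrite /conformal adjmxZ_real metric_selfadj.
- move=> i p ip v v0; rewrite /conformal -scalemxAr -scalemxAl mxE mulr_gt0//.
    by rewrite ltcR expR_gt0.
  exact: metric_posdef.
- move=> i j p /overlapE ip; rewrite /conformal (metric_transition ip).
  by rewrite (chartV_transition ip) -scalemxAr -scalemxAl.
Qed.

Definition complex_hessian f : local_forms X := fun i p =>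
  \matrix_(k, l) dz k (dzbar l (fun q => (f (chartV i q))%:C)) p.

Definition laplacian f i p : R :=
  complex.Re (\tr (invmx (g i p) *m complex_hessian f i p)).

Lemma smooth_csmooth_pullback f i : smooth_fun f ->
  csmooth_on (codom_of i) (fun q => (f (chartV i q))%:C).
Proof. by move=> sf; apply: csmooth_real; exact: sf. Qed.

Lemma log_det_csmooth i : csmooth_on (codom_of i) (fun q => (ln (metric_det i q))%:C).
Proof.
apply: csmooth_real; apply: (smooth_ln (@codom_open R n X i)).
  by move=> p ip; have [] := metric_detE ip.
exact: metric_det_smooth.
Qed.

Lemma conformal_det f i p : codom_of i p ->
  complex.Re (\det (conformal f g i p)) =
  expR (n%:R * f (chartV i p)) * metric_det i p.
Proof.
move=> ip; rewrite /conformal detZ (metric_detE ip).2 -rmorphXn -rmorphM /=.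
by rewrite expRM_natl.
Qed.

(** The determinant of exp(t f) g is exp(n t f) times that of g, so its logarithm
    changes by n t f. *)
Lemma ricci_conformal f t i p : smooth_fun f -> codom_of i p ->
  ricci (conformal (fun x => t * f x) g) i p =
  ricci g i p - (n%:R * t)%:C *: complex_hessian f i p.
Proof.
move=> sf ip; have Uo := @codom_open R n X i.
apply/matrixP => k l; rewrite !mxE.
set F := fun q => (f (chartV i q))%:C.
set G := fun q => (ln (metric_det i q))%:C.
have sF : csmooth_on (codom_of i) F by exact: smooth_csmooth_pullback.
have sG : csmooth_on (codom_of i) G by exact: log_det_csmooth.
have dF q (iq : codom_of i q) := csmooth_cderivable sF iq.
have dG q (iq : codom_of i q) := csmooth_cderivable sG iq.
have E1 q : codom_of i q ->
    (ln (complex.Re (\det (conformal (fun x => t * f x) g i q))))%:C =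
    (n%:R * t)%:C * F q + G q.
  move=> iq; have [D0 _] := metric_detE iq.
  rewrite conformal_det// lnM ?posrE ?expR_gt0// expRK /F /G.
  by rewrite -rmorphM -rmorphD /= mulrA.
have E2 q : codom_of i q ->
    dzbar l (fun q => (ln (complex.Re
      (\det (conformal (fun x => t * f x) g i q))))%:C) q =
    (n%:R * t)%:C * dzbar l F q + dzbar l G q.
  move=> iq; rewrite (dzbar_eq l Uo iq E1).
  have dcF := cderivableM (cderivable_cst (n%:R * t)%:C q) (dF q iq).
  by rewrite (dzbarD l dcF (dG q iq)) (dzbarZ _ l (dF q iq)).
rewrite (dz_eq k Uo ip E2).
have dF' := csmooth_cderivable (csmooth_dzbar l Uo sF) ip.
have dG' := csmooth_cderivable (csmooth_dzbar l Uo sG) ip.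
rewrite (dzD k (cderivableM (cderivable_cst (n%:R * t)%:C p) dF') dG').
by rewrite (dzZ _ k dF') opprD addrC.
Qed.

(** Rescaling by exp(t f) multiplies the volume by exp(n t f) and the inverse metric
    by exp(- t f).  In dimension n > 1 the remaining weight, of exponent
    (n - 1) t f, makes the maximum of f dominate for large t. *)
Lemma conformal_density f t i p : (0 < n)%N -> smooth_fun f -> codom_of i p ->
  scalar_curvature (conformal (fun x => t * f x) g) i p *
  top_power (conformal (fun x => t * f x) g) i p =
  expR (n.-1%:R * t * f (chartV i p)) *
  (scalar_curvature g i p * top_power g i p +
   t * (- (n%:R * laplacian f i p * top_power g i p))).
Proof.
move=> n0 sf ip.
have E1 : scalar_curvature (conformal (fun x => t * f x) g) i p =
    expR (- (t * f (chartV i p))) *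
    (scalar_curvature g i p - n%:R * t * laplacian f i p).
  rewrite /scalar_curvature (ricci_conformal _ sf ip) /conformal.
  rewrite invmxZ; last first.
    rewrite unitmxE detZ unitfE mulf_neq0 ?expf_neq0//.
      by rewrite (_ : 0 = 0%:C)// (inj_eq (@complexI R)) gt_eqF ?expR_gt0.
    by rewrite -unitfE -unitmxE metric_unit.
  rewrite -fmorphV -expRN /= -scalemxAl mxtraceZ mulmxBr -scalemxAr.
  rewrite linearB /= mxtraceZ /laplacian.
  move: (\tr _) (\tr _) => x y; case: x y => a b [c d] /=.
  by ring.
have E2 : top_power (conformal (fun x => t * f x) g) i p =
    expR (n%:R * (t * f (chartV i p))) * top_power g i p.
  by rewrite /top_power conformal_det// mulrCA.
have E3 : expR (n.-1%:R * t * f (chartV i p)) =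
    expR (- (t * f (chartV i p))) * expR (n%:R * (t * f (chartV i p))).
  have En : n%:R = n.-1%:R + 1 :> R by rewrite natr1 prednK.
  by rewrite -expRD En; congr expR; ring.
rewrite E1 E2 E3; ring.
Qed.

Lemma csmooth_trace_inv (A : index X -> 'rV[R]_(n + n) -> 'M[R[i]]_n) i :
  (forall k l, csmooth_on (codom_of i) (fun p => A i p k l)) ->
  smooth_on (codom_of i) (fun p => complex.Re (\tr (invmx (g i p) *m A i p))).
Proof.
move=> sA; have Uo := @codom_open R n X i.
have sI : forall k l, csmooth_on (codom_of i) (fun p => invmx (g i p) k l).
  apply: (csmooth_invmx Uo) => [p ip|]; last exact: metric_csmooth.
  by rewrite -unitfE -unitmxE metric_unit.
have sM := csmooth_mulmx Uo sI sA.
have sT : csmooth_on (codom_of i) (fun p => \tr (invmx (g i p) *m A i p)).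
  by rewrite /mxtrace; apply: (csmooth_sum Uo) => k _; exact: (sM k k).
exact: sT.1.
Qed.

Lemma top_power_smooth i : smooth_on (codom_of i) (top_power g i).
Proof.
have Uo := @codom_open R n X i.
exact: (smoothZ Uo (n`!%:R * 2 ^+ n) (@metric_det_smooth i)).
Qed.

Lemma top_power_gt0 i p : codom_of i p -> 0 < top_power g i p.
Proof.
move=> ip; rewrite /top_power !mulr_gt0 ?exprn_gt0 ?ltr0n ?fact_gt0//.
by have [] := metric_detE ip.
Qed.

Lemma scalar_curvature_smooth i : smooth_on (codom_of i) (scalar_curvature g i).
Proof.
have Uo := @codom_open R n X i.
apply: csmooth_trace_inv => k l.
apply: (csmooth_eq Uo _ (csmoothN Uo (csmooth_dz k Uo
  (csmooth_dzbar l Uo (log_det_csmooth i))))) => p _.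
by rewrite mxE.
Qed.

Lemma laplacian_smooth f i : smooth_fun f -> smooth_on (codom_of i) (laplacian f i).
Proof.
move=> sf; have Uo := @codom_open R n X i.
apply: csmooth_trace_inv => k l.
apply: (csmooth_eq Uo _ (csmooth_dz k Uo
  (csmooth_dzbar l Uo (smooth_csmooth_pullback i sf)))) => p _.
by rewrite mxE.
Qed.

End Conformal.

(** * Complex Hessian of a bump function at its centre *)

Section HessianOfProfile.
Context {R : realType} {n : nat}.
Implicit Types (u : 'rV[R]_(n + n) -> R) (phi : R -> R).

Lemma cpartial_real_comp phi d u p k :
  is_derive (u p) (1 : R) phi d -> derivable u p (delta_mx 0 k) ->
  cpartial k (fun q => (phi (u q))%:C) p = d%:C * cpartial k (fun q => (u q)%:C) p.
Proof.
move=> dphi du; rewrite /cpartial /partial /= derive_cst.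
have [_ E] := derive_comp1 dphi du.
have -> : 'D_(delta_mx 0 k) (fun q => phi (u q)) p =
  'D_(delta_mx 0 k) u p * d := E.
by apply/eqP; rewrite eq_complex /= !(mulr0, mul0r) addr0 subr0 mulrC !eqxx.
Qed.

Lemma dzbar_real_comp phi d u p k :
  is_derive (u p) (1 : R) phi d -> (forall j, derivable u p (delta_mx 0 j)) ->
  dzbar k (fun q => (phi (u q))%:C) p = d%:C * dzbar k (fun q => (u q)%:C) p.
Proof.
move=> dphi du; rewrite /dzbar !(cpartial_real_comp dphi (du _)).
exact: half_sum_lin.
Qed.

End HessianOfProfile.

Section BumpHessian.
Context {R : realType} {n : nat} (X : complexManifold R n).
Variables (i0 : index X) (x0 : X) (r : R).
Hypothesis i0x0 : dom i0 x0.
Hypothesis r0 : 0 < r.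
Variable i : index X.
Hypothesis ix0 : dom i x0.

Let p0 := chart i0 x0.
Let p := chart i x0.
Let U := pull i (dom i0).
Let T := transition i i0.
Let w b q : R[i] := zcoord b (T q) - zcoord b p0.
Let v q : R := r ^+ 2 - sqdist p0 (T q).

Let Uo : open U.
Proof. by apply: open_pull; exact: dom_open. Qed.

Let Up : U p.
Proof. by split; [exact: codom_chart|rewrite /= chartK]. Qed.

Let Tp : T p = p0.
Proof. by rewrite /T /transition /= /p chartK. Qed.

Lemma sqdist_zcoord q :
  (v q)%:C = (r ^+ 2)%:C + -1 * \sum_b w b q * Num.conj (w b q).
Proof.
rewrite mulN1r rmorphB /=; congr (_ - _).
rewrite /sqdist big_split_ord /= -big_split /= rmorph_sum; apply: eq_bigr => b _.
rewrite /w /zcoord /=; move: (T q 0 _) (T q 0 _) (p0 0 _) (p0 0 _) => a c d e.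
by apply/eqP; rewrite eq_complex /=; apply/andP; split; apply/eqP; ring.
Qed.

Let sw b : csmooth_on U (w b).
Proof. exact: (csmoothD Uo (transition_zcoord i i0 b) (csmooth_cst _ _)). Qed.

Let sw' b : csmooth_on U (fun q => w b q * Num.conj (w b q)).
Proof. exact: (csmoothM Uo (sw b) (csmooth_conj Uo (sw b))). Qed.

Let dw b k q : U q -> dz k (w b) q = dz k (fun q => zcoord b (T q)) q.
Proof.
move=> Uq; have dT := csmooth_cderivable (transition_zcoord i i0 b) Uq.
by rewrite (dzD k dT (cderivable_cst _ _)) dz_cst addr0.
Qed.

Let dbw b k q : U q -> dzbar k (w b) q = 0.
Proof.
move=> Uq; have dT := csmooth_cderivable (transition_zcoord i i0 b) Uq.
by rewrite (dzbarD k dT (cderivable_cst _ _)) dzbar_cst addr0 transition_dzbar.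
Qed.

Let wp b : w b p = 0.
Proof. by rewrite /w Tp subrr. Qed.

Let sv : smooth_on U v.
Proof.
apply: (smoothB Uo (smooth_cst _)).
by apply: (sqdist_smooth _ Uo) => j; exact: transition_smooth.
Qed.

(** The coordinates [w b] of the transition are holomorphic, so only the conjugate
    factors of the squared distance contribute. *)
Lemma dzbar_sqdist l q : U q ->
  dzbar l (fun q => (v q)%:C) q =
  -1 * \sum_b w b q * Num.conj (dz l (fun q => zcoord b (T q)) q).
Proof.
move=> Uq.
rewrite (dzbar_eq l Uo Uq (fun q _ => sqdist_zcoord q)).
have dw2 b := csmooth_cderivable (sw' b) Uq.
have dS := cderivable_sum (index_enum 'I_n) dw2.
have dNS := cderivableM (cderivable_cst (-1) q) dS.
rewrite (dzbarD l (cderivable_cst _ _) dNS) dzbar_cst add0r (dzbarZ _ l dS).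
rewrite (dzbar_sum _ l dw2); congr (_ * _); apply: eq_bigr => b _.
have db := csmooth_cderivable (sw b) Uq.
by rewrite (dzbarM l db (cderivable_conj db)) (dbw _ _ Uq) mul0r add0r (dzbar_conj _ db) (dw _ _ Uq).
Qed.

Let J := hjacobian T p.

Lemma dz_dzbar_sqdist k l :
  dz k (dzbar l (fun q => (v q)%:C)) p = - (J *m adjmx J) k l.
Proof.
rewrite (dz_eq k Uo Up (@dzbar_sqdist l)).
have sd b : csmooth_on U (fun q => w b q * Num.conj (dz l (fun q => zcoord b (T q)) q)).
  exact: (csmoothM Uo (sw b) (csmooth_conj Uo (csmooth_dz l Uo (transition_zcoord i i0 b)))).
have dd b := csmooth_cderivable (sd b) Up.
rewrite (dzZ _ k (cderivable_sum (index_enum 'I_n) dd)) mulN1r; congr (- _).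
rewrite (dz_sum _ k dd) mxE; apply: eq_bigr => b _.
have d1 := csmooth_cderivable (sw b) Up.
have d2 := csmooth_cderivable (csmooth_conj Uo
  (csmooth_dz l Uo (transition_zcoord i i0 b))) Up.
by rewrite (dzM k d1 d2) wp mul0r addr0 dw// adjmxE !mxE.
Qed.

(** The first derivatives of the squared distance vanish at the centre.  Hence the
    Hessian of the bump is the derivative of the profile times the Hessian of
    minus the squared distance, which is - J J^* in every chart around the
    centre. *)
Lemma bump_hessian : exists2 d : R, 0 < d &
  complex_hessian (chart_bump i0 x0 r) i p = (- d)%:C *: (J *m adjmx J).
Proof.
pose phi1 := flat (flat_next 1) : R -> R.
have dphi x : is_derive x (1 : R) bump_profile (phi1 x) by exact: flat_derive.
have d0 : 0 < phi1 (r ^+ 2) by apply: profile_derive_gt0; exact: exprn_gt0.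
exists (phi1 (r ^+ 2)) => //.
have vp : v p = r ^+ 2 by rewrite /v Tp sqdist0 subr0.
have dv q : U q -> forall j, derivable v q (delta_mx 0 j).
  by move=> Uq j; exact: smooth_derivable sv Uq.
apply/matrixP => k l; rewrite [LHS]mxE [RHS]mxE.
have E1 q : U q -> dzbar l (fun q => (chart_bump i0 x0 r (chartV i q))%:C) q =
    (phi1 (v q))%:C * dzbar l (fun q => (v q)%:C) q.
  move=> Uq.
  rewrite -(dzbar_real_comp l (dphi (v q)) (dv q Uq)).
  by apply: (dzbar_eq l Uo Uq) => z Uz; rewrite bump_pull.
rewrite (dz_eq k Uo Up E1).
have s1 : csmooth_on U (fun q => (phi1 (v q))%:C).
  apply: csmooth_real.
  exact: (smooth_comp1 Uo 0 (flat_tower (flat_next 1)) (fun _ _ => I) sv).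
have d1 := csmooth_cderivable s1 Up.
have d2 := csmooth_cderivable (csmooth_dzbar l Uo (csmooth_real sv)) Up.
rewrite (dzM k d1 d2) dz_dzbar_sqdist vp dzbar_sqdist//.
rewrite big1 => [|b _]; last by rewrite wp mul0r.
by rewrite !mulr0 add0r mulrN rmorphN mulNr.
Qed.

End BumpHessian.

(** * Auxiliary estimates for the concentration argument *)

Section Concentration.
Context {R : realType}.

Lemma iteratedZ m M a (f : 'rV[R]_m -> R) : compactly_supported M f ->
  iterated_integral (fun v => a * f v) = a * iterated_integral f.
Proof.
move=> cf.
have cz : compactly_supported M (fun _ : 'rV[R]_m => 0 : R).
  by split => // v; exact: cst_continuous.
have z0 : iterated_integral (fun _ : 'rV[R]_m => 0 : R) = 0.
  have := iterated_lin (-1) cz cz.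
  by rewrite (_ : (fun=> _) = fun=> 0) ?mulN1r ?addNr//; apply/funext => v; rewrite mulr0 addr0.
have := iterated_lin a cf cz; rewrite z0 addr0 => <-.
by congr iterated_integral; apply/funext => v; rewrite addr0.
Qed.

Lemma iterated_comb m M a b (f h : 'rV[R]_m -> R) :
  compactly_supported M f -> compactly_supported M h ->
  iterated_integral (fun v => a * f v + b * h v) =
  a * iterated_integral f + b * iterated_integral h.
Proof.
move=> cf ch; rewrite -(iteratedZ b ch).
apply: (iterated_lin (M := M)) => //; split=> [v|v vM].
  have bc : {for v, continuous (fun _ : 'rV[R]_m => b)} by exact: cst_continuous.
  exact: continuousM bc (ch.1 v).
by rewrite ch.2// mulr0.
Qed.

Lemma bounded_on_compact (T : topologicalType) (K : set T) (h : T -> R) : compact K ->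
  (forall p, K p -> {for p, continuous h}) ->
  exists2 C, 0 <= C & forall p, K p -> `|h p| <= C.
Proof.
move=> cK hc.
have ch : compact (h @` K).
  apply: continuous_compact cK; apply: continuous_in_subspaceT => p.
  by rewrite inE => Kp; exact: hc.
have [C [_ HC]] := compact_bounded ch.
exists (`|C| + 1); first by rewrite addr_ge0.
move=> p Kp; apply: (HC (`|C| + 1)); last by exists p.
by rewrite (le_lt_trans (ler_norm C))// ltrDl.
Qed.

(** exp x is the square of exp (x / 2), hence at least x^2 / 4 for x >= 0: the left
    side is linear in t and the right side at least quadratic. *)
Lemma exp_beats_linear (A B e T : R) : 0 < A -> 0 <= B -> 0 < e ->
  exists t, [/\ T <= t, 0 <= t & B * (1 + t) < expR (t * e) * A].
Proof.
move=> A0 B0 e0.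
(* As t >= 1, it suffices that 2 B t < (t e / 2)^2 A, that is 8 B < t e^2 A. *)
pose t := `|T| + 1 + 8 * B / (e ^+ 2 * A).
have q0 : 0 <= 8 * B / (e ^+ 2 * A).
  apply: divr_ge0; first by rewrite mulr_ge0.
  by rewrite mulr_ge0 ?sqr_ge0// ltW.
have t1 : 1 <= t by rewrite /t addrAC lerDr addr_ge0.
have t0 : 0 < t by apply: lt_le_trans t1.
exists t; split.
- by rewrite /t -addrA (le_trans (ler_norm T))// lerDl addr_ge0.
- exact: ltW.
- have te : 0 < t * e / 2 by rewrite divr_gt0// mulr_gt0.
  apply: (@lt_le_trans _ _ ((t * e / 2) ^+ 2 * A)); last first.
    rewrite ler_wpM2r ?(ltW A0)// (_ : expR (t * e) = expR (t * e / 2) ^+ 2); last first.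
      by rewrite expr2 -expRD -splitr.
    rewrite ler_pXn2r ?nnegrE ?expR_ge0 ?(ltW te)//.
    by apply: le_trans (expR_ge1Dx _); rewrite lerDr.
  have H : 8 * B < t * (e ^+ 2 * A).
    rewrite -ltr_pdivrMr ?mulr_gt0 ?exprn_gt0// /t ltrDr.
    by rewrite ltr_wpDl.
  apply: (@le_lt_trans _ _ (B * (2 * t))).
    by apply: ler_wpM2l => //; lra.
  have -> : (t * e / 2) ^+ 2 * A = (t * (e ^+ 2 * A)) * (t / 4) by field.
  have -> : B * (2 * t) = (8 * B) * (t / 4) by field.
  by rewrite ltr_pM2r// divr_gt0.
Qed.

End Concentration.

(** * Integrals over the manifold, chart by chart *)

Section PartitionIntegral.
Context {R : realType} {n : nat} (X : complexManifold R n).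
Hypothesis X_compact : compact [set: X].

Definition chart_integrand (i : index X) (phi : X -> R)
    (h : 'rV[R]_(n + n) -> R) : 'rV[R]_(n + n) -> R :=
  fun p => \1_(codom_of i) p * (phi (chartV i p) * h p).

(** The definition of the integral selects one partition of unity, about which
    nothing more is known; all later estimates hold for an arbitrary one. *)
Lemma total_scalar_curvatureE :
  exists N (c : 'I_N -> index X) (rho : 'I_N -> X -> R),
  smooth_partition c rho /\ forall g : local_forms X,
    total_scalar_curvature g = \sum_k iterated_integral
      (chart_integrand (c k) (rho k)
        (fun p => scalar_curvature g (c k) p * top_power g (c k) p)).
Proof.
pose s := some_partition X.
have sP : partition_of_unity s.
  rewrite /s /some_partition; case: pselect => [ex|[]].
    exact: (projT2 (cid ex)).
  exact: partition_exists.
exists (size s), (fun k => (tnth (in_tuple s) k).1), (fun k => (tnth (in_tuple s) k).2).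
split; first exact: partition_indexed.
by move=> g; rewrite /total_scalar_curvature /manifold_integral big_tnth.
Qed.

Variables (i : index X) (phi : X -> R).
Hypothesis phi_smooth : smooth_fun phi.
Hypothesis phi_support : closure [set x | phi x != 0] `<=` dom i.

Definition chart_support : set 'rV[R]_(n + n) :=
  chart i @` closure [set x | phi x != 0].

Lemma chart_support_compact : compact chart_support.
Proof.
apply: continuous_compact.
  apply: continuous_in_subspaceT => x; rewrite inE => /phi_support ix.
  exact: chart_continuous.
apply: (subclosed_compact _ X_compact) => //; exact: closed_closure.
Qed.

Lemma chart_support_codom : chart_support `<=` codom_of i.
Proof. by move=> _ [x /phi_support ix <-]; exact: codom_chart. Qed.

Lemma chart_supportP p : codom_of i p -> phi (chartV i p) != 0 -> chart_support p.
Proof.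
by move=> ip xp; exists (chartV i p); [exact: subset_closure|exact: chartVK].
Qed.

Lemma chart_integrand_out h p : ~ chart_support p -> chart_integrand i phi h p = 0.
Proof.
move=> Kp; rewrite /chart_integrand indicE; case: (boolP (p \in codom_of i)) => ip.
  have [->|x0] := eqVneq (phi (chartV i p)) 0; first by rewrite mul0r mulr0.
  by case: Kp; apply: chart_supportP => //; rewrite inE in ip.
by rewrite mul0r.
Qed.

Lemma chart_integrand_in h p : codom_of i p ->
  chart_integrand i phi h p = phi (chartV i p) * h p.
Proof. by move=> ip; rewrite /chart_integrand indicE mem_set// mul1r. Qed.

(** The radius M depends only on the support of phi, so that integrands with
    different densities h can be compared and added. *)
Lemma chart_integrand_compact : exists2 M, 0 <= M &
  forall h, (forall p, codom_of i p -> {for p, continuous h}) ->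
    compactly_supported M (chart_integrand i phi h).
Proof.
have [M M0 HM] := bounded_on_compact chart_support_compact
  (fun p _ => @norm_continuous R _ p).
exists M => // h hc; split; last first.
  move=> p Mp; apply: chart_integrand_out => /HM.
  by rewrite normr_id leNgt Mp.
have Kcl : closed chart_support.
  apply: (compact_closed _ chart_support_compact); exact: norm_hausdorff.
move=> p; have [ip|ip] := pselect (codom_of i p).
  have c1 : {for p, continuous (phi \o chartV i)}.
    exact: smooth_continuous (phi_smooth (i := i)) ip.
  apply: (continuous_eq_open (@codom_open R n X i) ip _ (continuousM c1 (hc p ip))).
  by move=> q iq; rewrite chart_integrand_in.
have cz : {for p, continuous (fun _ : 'rV[R]_(n + n) => 0 : R)}.
  exact: cst_continuous.
apply: (continuous_eq_open (closed_openC Kcl) _ _ cz).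
  by move=> /chart_support_codom.
by move=> q Kq; rewrite chart_integrand_out.
Qed.

End PartitionIntegral.

(** * Concentration of the total curvature at a point *)

Section PositiveTotalCurvature.
Context {R : realType} {n : nat} (X : complexManifold R n).
Hypothesis X_compact : compact [set: X].
Variable g : local_forms X.
Hypothesis gH : hermitian_metric g.
Hypothesis n_gt1 : (1 < n)%N.
Variables (i0 : index X) (x0 : X) (r : R).
Hypothesis i0x0 : dom i0 x0.
Hypothesis r0 : 0 < r.
Hypothesis ball_codom :
  forall q, sqdist (chart i0 x0) q <= r ^+ 2 -> codom_of i0 q.

Let f := chart_bump i0 x0 r.
Let fmax := bump_profile (r ^+ 2).

Let sf : smooth_fun f.
Proof. by apply: bump_smooth => //; exact: (@manifold_hausdorff R n X). Qed.

(** In every chart the total curvature of exp(t f) g has the density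
    exp((n - 1) t f) ([base_density] + t [hessian_density]). *)
Definition base_density i p : R := scalar_curvature g i p * top_power g i p.

Definition hessian_density i p : R := - (n%:R * laplacian g f i p * top_power g i p).

Lemma density_continuous i p : codom_of i p ->
  {for p, continuous (base_density i)} /\ {for p, continuous (hessian_density i)}.
Proof.
move=> ip; have Uo := @codom_open R n X i.
have sT := @top_power_smooth R n X g gH i.
have sL := smoothM Uo (smoothZ Uo n%:R (@laplacian_smooth R n X g gH f i sf)) sT.
split.
  exact: smooth_continuous (smoothM Uo (@scalar_curvature_smooth R n X g gH i) sT) ip.
exact: smooth_continuous (smoothN Uo sL) ip.
Qed.

(** Read in any chart, the Laplacian of the bump at its centre is a negative multiple
    of the trace of the inverse metric in the chart i0, by [bump_hessian] and
    [trace_invmx_congruence]. *)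
Lemma hessian_density_center i : dom i x0 -> 0 < hessian_density i (chart i x0).
Proof.
move=> ix; have ip : codom_of i (chart i x0) by exact: codom_chart.
have ip0 : codom_of i0 (chart i0 x0) by exact: codom_chart.
have n0 : (0 < n)%N by exact: ltnW.
rewrite /hessian_density -mulNr -mulrN; apply: mulr_gt0; last exact: top_power_gt0.
apply: mulr_gt0; first by rewrite ltr0n.
rewrite /laplacian; have [d d0 ->] := bump_hessian i0x0 r0 ix.
have pul : pull i (dom i0) (chart i x0) by split => //=; rewrite chartK.
rewrite (metric_transition gH pul) -scalemxAr mxtraceZ.
have uJ : hjacobian (transition i i0) (chart i x0) \in unitmx.
  by apply: jacobian_unit => //; rewrite chartK.
have Tp : transition i i0 (chart i x0) = chart i0 x0 by rewrite /transition /= chartK.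
rewrite Tp (trace_invmx_congruence uJ (metric_unit gH ip0)).
have [tr0 ->] := Re_gt0
  (posdef_trace_inv n0 (metric_selfadj gH ip0) (metric_posdef gH ip0)).
by rewrite -rmorphM /= mulNr opprK mulr_gt0.
Qed.

(** The bump decreases with the distance to the centre, so its superlevel sets
    shrink to the centre. *)
Lemma bump_level (W : set X) : nbhs x0 W ->
  exists2 e, 0 < e & forall x, fmax - e < f x -> W x.
Proof.
move=> xW.
have ip0 : codom_of i0 (chart i0 x0) by exact: codom_chart.
have : nbhs (chart i0 x0) (chartV i0 @^-1` W).
  by apply: (chartV_continuous ip0); rewrite chartK.
move=> /nbhs_ballP[d /= d0 dP].
pose e := d / 2; have e0 : 0 < e by rewrite divr_gt0.
exists (fmax - bump_profile (r ^+ 2 - e ^+ 2)).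
  rewrite subr_gt0; apply: profile_strict; first exact: exprn_gt0.
  by rewrite gtrBl exprn_gt0.
move=> x; rewrite opprB addrC subrK /f /chart_bump; case: pselect => /= [ix|_]; last first.
  by rewrite ltNge profile_ge0.
move=> /profile_lt; rewrite ltrD2l ltrN2 => /ltW H.
rewrite -(chartK ix); apply: dP; apply: sqdist_ball H; first exact: ltW.
by rewrite ltr_pdivrMr// ltr_pMr// ltr1n.
Qed.

(** The two densities are bounded on the compact support of phi.  If the chart
    contains the centre, the Hessian density stays above half of its central
    value on a neighbourhood W, so that t times it dominates; otherwise phi
    vanishes on a neighbourhood of the centre. *)
Lemma chart_estimates (i : index X) (phi : X -> R) : smooth_fun phi ->
  closure [set x | phi x != 0] `<=` dom i ->
  exists CT : R * R, exists W : set X, [/\ 0 <= CT.1, 0 <= CT.2, nbhs x0 W,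
    forall p, codom_of i p -> phi (chartV i p) != 0 ->
      `|base_density i p| <= CT.1 /\ `|hessian_density i p| <= CT.1
  & forall t p, CT.2 <= t -> codom_of i p -> phi (chartV i p) != 0 ->
      W (chartV i p) -> 1 <= base_density i p + t * hessian_density i p].
Proof.
move=> sphi cl.
have cK := chart_support_compact X_compact cl.
have Kc := chart_support_codom cl.
have [C1 C10 HC1] := bounded_on_compact cK (fun p Kp => (density_continuous (Kc p Kp)).1).
have [C2 C20 HC2] := bounded_on_compact cK (fun p Kp => (density_continuous (Kc p Kp)).2).
have bnd p : codom_of i p -> phi (chartV i p) != 0 ->
    `|base_density i p| <= C1 + C2 /\ `|hessian_density i p| <= C1 + C2.
  move=> ip xp; have Kp := chart_supportP ip xp.
  split; first by apply: (le_trans (HC1 p Kp)); rewrite lerDl.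
  by apply: (le_trans (HC2 p Kp)); rewrite lerDr.
have [ix|ix] := pselect (dom i x0); last first.
  exists (C1 + C2, 0), (~` closure [set x | phi x != 0]); split => //=.
  - exact: addr_ge0.
  - apply: open_nbhs_nbhs; split; first by apply: closed_openC; exact: closed_closure.
    by move=> /cl.
  - by move=> t p _ _ xp []; exact: subset_closure.
pose dl := hessian_density i (chart i x0) / 2.
have dl0 : 0 < dl by rewrite divr_gt0// hessian_density_center.
(* Beyond this threshold t dl exceeds the bound on the base density by 1. *)
exists (C1 + C2, (C1 + C2 + 1) / dl),
  [set y | dom i y /\ dl < hessian_density i (chart i y)].
split => /=.
- exact: addr_ge0.
- by rewrite divr_ge0 ?addr_ge0// ltW.
- apply: filterI.
    by apply: open_nbhs_nbhs; split => //; exact: dom_open.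
  have hc := (density_continuous (codom_chart ix)).2.
  have cc : {for x0, continuous (hessian_density i \o chart i)}.
    by apply: continuous_comp => //; exact: chart_continuous.
  apply: (cvgr_gt _ cc dl).
  by rewrite /dl /= ltr_pdivrMr// ltr_pMr ?ltr1n// hessian_density_center.
- exact: bnd.
- move=> t p Tt ip xp [_]; rewrite chartVK// => dlp.
  have [/ler_normlP[Sb _] _] := bnd p ip xp.
  have : C1 + C2 + 1 <= t * hessian_density i p.
    rewrite ler_pdivrMr// in Tt; apply: (le_trans Tt).
    apply: ler_wpM2l; last exact: ltW.
    rewrite -(pmulr_lge0 _ dl0); apply: le_trans Tt.
    by rewrite !addr_ge0.
  lra.
Qed.

(** Three regions are distinguished.  Where f is above fmax - e / 2 the density is
    at least its weight, hence at least E = exp((n - 1) t (fmax - e / 2)).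
    Between fmax - e and fmax - e / 2 it is nonnegative.  Below fmax - e the
    weight is at most exp((n - 1) t (fmax - e)), and the other factor at least
    - C (1 + t).  The smooth profile of f - (fmax - e / 2), which lies in [0, 1],
    serves as the indicator of the first region. *)
Lemma conformal_integrand_bound (i : index X) (phi : X -> R) (C T e t : R) (W : set X) :
  (forall x, 0 <= phi x) -> 0 <= C -> 0 < e -> T <= t -> 0 <= t ->
  (forall p, codom_of i p -> phi (chartV i p) != 0 ->
      `|base_density i p| <= C /\ `|hessian_density i p| <= C) ->
  (forall t p, T <= t -> codom_of i p -> phi (chartV i p) != 0 ->
      W (chartV i p) -> 1 <= base_density i p + t * hessian_density i p) ->
  (forall x, fmax - e < f x -> W x) ->
  forall p,
  expR (n.-1%:R * t * (fmax - e / 2)) *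
    chart_integrand i phi (fun p => bump_profile (f (chartV i p) - (fmax - e / 2))) p +
  - (C * (1 + t) * expR (n.-1%:R * t * (fmax - e))) *
    chart_integrand i phi (fun=> 1) p <=
  chart_integrand i phi (fun p => expR (n.-1%:R * t * f (chartV i p)) *
    (base_density i p + t * hessian_density i p)) p.
Proof.
move=> phi0 C0 e0 Tt t0 bnd pos lev p.
have [ip|ip] := pselect (codom_of i p); last first.
  have z h : chart_integrand i phi h p = 0.
    by rewrite /chart_integrand indicE memNset// mul0r.
  by rewrite !z !mulr0 addr0.
rewrite !chart_integrand_in//; set x := chartV i p.
have [->|xp] := eqVneq (phi x) 0; first by rewrite !mul0r !mulr0 addr0.
set S := base_density i p; set L := hessian_density i p.
set E := expR _; set E' := expR _; set F := expR _.
set eta := bump_profile _.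
have mt0 : 0 <= n.-1%:R * t by rewrite mulr_ge0.
have D0 : 0 <= C * (1 + t) * E'.
  by rewrite !mulr_ge0 ?expR_ge0// addr_ge0.
have -> : E * (phi x * eta) + - (C * (1 + t) * E') * (phi x * 1) =
  phi x * (E * eta - C * (1 + t) * E') by ring.
apply: ler_wpM2l => //.
have [ef|ef] := ltP (fmax - e) (f x).
  have SL := pos t p Tt ip xp (lev x ef); rewrite -/S -/L in SL.
  have [ef2|ef2] := ltP (fmax - e / 2) (f x).
    have EF : E <= F by rewrite ler_expR ler_wpM2l// ltW.
    apply: (@le_trans _ _ (E * 1)).
      rewrite lerBlDr; apply: (@le_trans _ _ (E * 1)); last by rewrite lerDl.
      by rewrite ler_wpM2l ?expR_ge0// profile_le1.
    by apply: ler_pM => //; exact: expR_ge0.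
  have -> : eta = 0 by apply: flat_neg; rewrite subr_le0.
  rewrite mulr0 sub0r; apply: (@le_trans _ _ 0); first by rewrite oppr_le0.
  by rewrite mulr_ge0 ?expR_ge0// (le_trans _ SL).
have -> : eta = 0.
  apply: flat_neg; rewrite subr_le0; apply: (le_trans ef).
  by rewrite lerD2l lerN2 ler_pdivrMr// ler_pMr// ler1n.
rewrite mulr0 sub0r.
have FE : F <= E' by rewrite ler_expR ler_wpM2l.
have [/ler_normlP[S1 _] /ler_normlP[L1 _]] := bnd p ip xp.
rewrite -/S -/L in S1 L1.
have SL : - (C * (1 + t)) <= S + t * L.
  have : t * - L <= t * C by rewrite ler_wpM2l.
  by nra.
apply: (@le_trans _ _ (F * - (C * (1 + t)))); last by rewrite ler_wpM2l ?expR_ge0.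
rewrite mulrN lerN2 mulrC ler_wpM2l// mulr_ge0// addr_ge0//.
Qed.

(** Summing [conformal_integrand_bound] over the charts, the positive part carries
    the weight at fmax - e / 2 and the negative part that at fmax - e.  Their
    ratio grows exponentially in t, whereas the coefficient of the negative part
    is linear in t. *)
Lemma conformal_total_gt0 : exists2 t,
  smooth_fun (fun x => t * f x) &
  0 < total_scalar_curvature (conformal (fun x => t * f x) g).
Proof.
have [N [c [rho [part total]]]] := total_scalar_curvatureE X_compact.
have [srho rho0 cl rho1] := part.
pose CTW k := cid (chart_estimates (srho k) (cl k)).
pose C := \sum_k (projT1 (CTW k)).1; pose T := \sum_k (projT1 (CTW k)).2.
pose Wk k := projT1 (cid (projT2 (CTW k))).
have WkP k := projT2 (cid (projT2 (CTW k))).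
have C0 : 0 <= C by apply: sumr_ge0 => k _; have [] := WkP k.
have CC k : (projT1 (CTW k)).1 <= C.
  by rewrite /C (bigD1 k)//= lerDl sumr_ge0// => l _; have [] := WkP l.
have TT k : (projT1 (CTW k)).2 <= T.
  by rewrite /T (bigD1 k)//= lerDl sumr_ge0// => l _; have [] := WkP l.
pose W : set X := [set x | forall k, Wk k x].
have xW : nbhs x0 W.
  by apply: (@filter_forall _ _ Wk (nbhs x0)) => k; have [] := WkP k.
have [e e0 lev] := bump_level xW.
pose eta i p := bump_profile (f (chartV i p) - (fmax - e / 2)).
pose Aint k := iterated_integral (chart_integrand (c k) (rho k) (eta (c k))).
pose Bint k := iterated_integral (chart_integrand (c k) (rho k) (fun=> 1)).
have eta_cont i p : codom_of i p -> {for p, continuous (eta i)}.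
  move=> ip; have Uo := @codom_open R n X i.
  have se := smooth_profile Uo (smoothB Uo (@sf i) (smooth_cst (fmax - e / 2))).
  exact: smooth_continuous se ip.
have one_cont (i : index X) p : codom_of i p ->
    {for p, continuous (fun _ : 'rV[R]_(n + n) => 1 : R)}.
  by move=> _; exact: cst_continuous.
have fin_ge0 k h p : (forall q, 0 <= h q) -> 0 <= chart_integrand (c k) (rho k) h p.
  by move=> h0; rewrite /chart_integrand !mulr_ge0// indicE ler0n.
have A_ge0 k : 0 <= Aint k.
  by apply: iterated_ge0 => p; apply: fin_ge0 => q; exact: profile_ge0.
have B_ge0 k : 0 <= Bint k.
  by apply: iterated_ge0 => p; apply: fin_ge0 => q; exact: ler01.
have A_gt0 : 0 < \sum_k Aint k.
  have [k kx] := partition_pos part x0.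
  rewrite (bigD1 k)//= ltr_wpDr//; first by apply: sumr_ge0.
  have kdom : dom (c k) x0 by apply: (partition_dom part); rewrite gt_eqF.
  have [M M0 HM] := chart_integrand_compact X_compact (srho k) (cl k).
  have cs := HM _ (eta_cont (c k)).
  apply: (iterated_gt0 (v := chart (c k) x0) M0 cs).
    by move=> p; apply: fin_ge0 => q; exact: profile_ge0.
  rewrite chart_integrand_in; last exact: codom_chart.
  rewrite mulr_gt0 ?chartK// /eta profile_gt0 chartK// subr_gt0.
  by rewrite /f bump_dom// sqdist0 subr0 gtrBl divr_gt0.
have B_sum : 0 <= C * \sum_k Bint k.
  by apply: mulr_ge0 => //; apply: sumr_ge0.
have m0 : 0 < n.-1%:R :> R by rewrite ltr0n -ltnS prednK// ltnW.
have me0 : 0 < n.-1%:R * (e / 2) by rewrite mulr_gt0// divr_gt0.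
have [t [Tt t0 Ht]] := exp_beats_linear T A_gt0 B_sum me0.
exists t => [i|]; first exact: (smoothZ (@codom_open R n X i) t (@sf i)).
rewrite total.
have dens k : chart_integrand (c k) (rho k) (fun p =>
    scalar_curvature (conformal (fun x => t * f x) g) (c k) p *
    top_power (conformal (fun x => t * f x) g) (c k) p) =
  chart_integrand (c k) (rho k) (fun p => expR (n.-1%:R * t * f (chartV (c k) p)) *
    (base_density (c k) p + t * hessian_density (c k) p)).
  apply/funext => p; have [ip|ip] := pselect (codom_of (c k) p).
    by rewrite !chart_integrand_in// (conformal_density gH t (ltnW n_gt1) sf ip).
  by rewrite /chart_integrand indicE memNset// !mul0r.
under eq_bigr => k _ do rewrite dens.
pose E := expR (n.-1%:R * t * (fmax - e / 2)).
pose E' := expR (n.-1%:R * t * (fmax - e)).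
have EE : E = E' * expR (t * (n.-1%:R * (e / 2))).
  by rewrite /E /E' -expRD; congr expR; field.
have key k : E * Aint k + - (C * (1 + t) * E') * Bint k <=
    iterated_integral (chart_integrand (c k) (rho k)
      (fun p => expR (n.-1%:R * t * f (chartV (c k) p)) *
        (base_density (c k) p + t * hessian_density (c k) p))).
  have [M M0 HM] := chart_integrand_compact X_compact (srho k) (cl k).
  have cA := HM _ (eta_cont (c k)); have cB := HM _ (one_cont (c k)).
  rewrite -(iterated_comb _ _ cA cB).
  have [_ _ _ bnd pos] := WkP k.
  apply: (iterated_le (M := M)).
  - split=> [p|p pM]; last by rewrite cA.2// cB.2// !mulr0 addr0.
    have cc a : {for p, continuous (fun _ : 'rV[R]_(n + n) => a : R)}.
      exact: cst_continuous.
    exact: (continuousD (continuousM (cc _) (cA.1 p)) (continuousM (cc _) (cB.1 p))).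
  - apply: HM => p ip; have [Sc Lc] := density_continuous ip.
    have Uo := @codom_open R n X (c k).
    have ec : {for p, continuous (fun p => expR (n.-1%:R * t * f (chartV (c k) p)))}.
      exact: smooth_continuous (smooth_exp Uo (smoothZ Uo (n.-1%:R * t) (@sf (c k)))) ip.
    have tc : {for p, continuous (fun _ : 'rV[R]_(n + n) => t)}.
      exact: cst_continuous.
    exact: (continuousM ec (continuousD Sc (continuousM tc Lc))).
  - apply: (conformal_integrand_bound (T := T) (W := W)) => //.
    + by move=> p ip xp; have [b1 b2] := bnd p ip xp;
        split; apply: le_trans (CC k).
    + move=> s p Ts ip xp Wp; apply: pos => //; last exact: Wp.
      exact: le_trans (TT k) Ts.
apply: lt_le_trans (ler_sum _ (fun k _ => key k)).
rewrite big_split /= -!mulr_sumr mulNr subr_gt0 EE.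
have -> : C * (1 + t) * E' * \sum_k Bint k = E' * (C * (\sum_k Bint k) * (1 + t)).
  by ring.
by rewrite -[ltRHS]mulrA ltr_pM2l ?expR_gt0.
Qed.

End PositiveTotalCurvature.

Lemma conformal_positive_total (R : realType) (n : nat) (X : complexManifold R n)
    (g : local_forms X) :
  compact [set: X] -> [set: X] !=set0 -> (1 < n)%N -> hermitian_metric g ->
  exists f : X -> R,
    [/\ smooth_fun f, hermitian_metric (conformal f g)
      & 0 < total_scalar_curvature (conformal f g)].
Proof.
move=> cX [x _] n1 gH.
have [i ix] := dom_cover x.
have [r r0 Hr] := chart_ball ix.
have [t sf pos] := conformal_total_gt0 cX gH n1 ix r0 Hr.
exists (fun y => t * chart_bump i x r y); split => //.
exact: conformal_hermitian.
Qed.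

Theorem theorem1p7 (R : realType) (n : nat) (X : complexManifold R n)
    (dim_gt1 : (1 < n)%N) (X_nonempty : [set: X] !=set0)
    (X_compact : compact [set: X]) :
  (exists g : local_forms X,
     hermitian_metric g /\ 0 < total_scalar_curvature g) /\
  ((exists g : local_forms X, kahler_metric g) ->
   exists (g0 : local_forms X) (f : X -> R),
     [/\ kahler_metric g0, smooth_fun f, hermitian_metric (conformal f g0)
       & 0 < total_scalar_curvature (conformal f g0)]).
Proof.
split.
  have [g gH] := hermitian_metric_exists X_compact.
  have [f [_ fH pos]] := conformal_positive_total X_compact X_nonempty dim_gt1 gH.
  by exists (conformal f g).
move=> [g gK].
have [f [sf fH pos]] := conformal_positive_total X_compact X_nonempty dim_gt1 gK.1.
by exists g, f.
Qed.
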